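(* Let $r\ge 3$, let $\vec q(x,t),\vec p(x,t)$ take values in $\mathbb{C}^{2r-1}$, and consider the nonlinear evolution equations (NLEE) for $\vec q,\vec p$ given by the compatibility of the Lax pair $$L\psi=i\partial_x\psi+(U_2+\lambda Q-\lambda^2J)\psi=0,\qquad M\psi=i\partial_t\psi+(V_4+\lambda V_3+\lambda^2V_2+\lambda^3Q-\lambda^4J)\psi=0,$$ with $J,Q,U_2,V_2,V_3,V_4$ as in the context. Fix the gauge by requiring that the potentials of both operators vanish at $\lambda=0$, i.e. put $\tilde\psi(x,t,\lambda)=g_0(x,t)\psi(x,t,\lambda)$ with $$i\partial_xg_0-g_0U_2=0,\qquad i\partial_tg_0-g_0V_4=0 .$$ Then $g_0$ is block-diagonal, the Lax pair takes the form $$\tilde L\tilde\psi=i\partial_x\tilde\psi+(\lambda\tilde Q-\lambda^2J)\tilde\psi=0,\qquad \tilde M\tilde\psi=i\partial_t\tilde\psi+(\lambda\tilde V_3+\lambda^2\tilde V_2+\lambda^3\tilde Q-\lambda^4J)\tilde\psi=0,$$ where $\tilde Q,\tilde V_2,\tilde V_3$ have the same block structure as $Q,V_2,V_3$, and, in terms of the blocks $\vec{\tilde q},\vec{\tilde p}$ of $\tilde Q$, the NLEE get the form $$i\partial_t\vec{\tilde q}+\partial_x^2\vec{\tilde q}+i\partial_x\left(2\vec{\tilde q}\,(\vec{\tilde q}^{\,T}\vec{\tilde p})-s_0\vec{\tilde p}\,(\vec{\tilde q}^{\,T}\vec{\tilde q})\right)=0,$$ $$i\partial_t\vec{\tilde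 p}-\partial_x^2\vec{\tilde p}-i\partial_x\left(2\vec{\tilde p}\,(\vec{\tilde q}^{\,T}\vec{\tilde p})-s_0\vec{\tilde q}\,(\vec{\tilde p}^{\,T}\vec{\tilde p})\right)=0 .$$
   Context: Matrices are $(2r+1)\times(2r+1)$, in block form with block sizes $1,2r-1,1$. $s_0=\sum_{k=1}^{2r-1}(-1)^kE_{k,2r-k}$ is a $(2r-1)\times(2r-1)$ matrix, $E_{kn}$ being the matrix unit $(E_{kn})_{pj}=\delta_{kp}\delta_{nj}$; $(\vec q,\vec p)=\vec q^{\,T}\vec p$; subscript $x$ denotes $\partial_x$. $$J=\begin{pmatrix}1&0&0\\0&0&0\\0&0&-1\end{pmatrix},\qquad Q=\begin{pmatrix}0&\vec q^{\,T}&0\\ \vec p&0&s_0\vec q\\0&\vec p^{\,T}s_0&0\end{pmatrix},$$ $$U_2=V_2=\begin{pmatrix}(\vec q,\vec p)&0&0\\0&s_0\vec q\,\vec p^{\,T}s_0-\vec p\,\vec q^{\,T}&0\\0&0&-(\vec q,\vec p)\end{pmatrix},\qquad V_3=i\begin{pmatrix}0&\vec q_x^{\,T}&0\\-\vec p_x&0&s_0\vec q_x\\0&-\vec p_x^{\,T}s_0&0\end{pmatrix},$$ and $V_4$ is block-diagonal with diagonal blocks $V_{4;11},V_{4;22},V_{4;33}$, where $$V_{4;11}=-V_{4;33}=i\left((\vec q_x,\vec p)-(\vec q,\vec p_x)\right)+(\vec q,\vec p)^2-\tfrac12(\vec q^{\,T}s_0\vec q)(\vec p^{\,T}s_0\vec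 p),$$ $$V_{4;22}=i\left(\vec p_x\vec q^{\,T}-\vec p\,\vec q_x^{\,T}+s_0(\vec q_x\vec p^{\,T}-\vec q\,\vec p_x^{\,T})s_0\right)-(\vec q,\vec p)\left(\vec p\,\vec q^{\,T}-s_0\vec q\,\vec p^{\,T}s_0\right).$$ The gauge-transformed coefficients are $\tilde Q=g_0Qg_0^{-1}$ and $\tilde V_k=g_0V_kg_0^{-1}$ ($k=2,3$), and $$\tilde Q=\begin{pmatrix}0&\vec{\tilde q}^{\,T}&0\\ \vec{\tilde p}&0&s_0\vec{\tilde q}\\0&\vec{\tilde p}^{\,T}s_0&0\end{pmatrix}.$$
   Formalization: Corrected: the factors q̃ᵀq̃, p̃ᵀp̃ become q̃ᵀs₀q̃, p̃ᵀs₀p̃, and the derivative term of the p̃ equation has sign + (as printed, false for q=e^{2it}e₁, p=e^{-2it}e₁). Added: g₀ at some point is diag(a,A,1/a), Aᵀs₀A=s₀; q,p are C² and g₀ is C¹ on the plane. *)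

(* Defs.v *)
From HB Require Import structures.
From mathcomp Require Import all_boot all_order all_algebra.
From mathcomp Require Import complex.
From mathcomp Require Import all_classical all_reals all_analysis.

Set Implicit Arguments.
Unset Strict Implicit.
Unset Printing Implicit Defensive.

Import Order.TTheory GRing.Theory Num.Theory.
Import numFieldNormedType.Exports.

Local Open Scope classical_set_scope.
Local Open Scope ring_scope.

Section Calculus.
Variable R : realType.

(* R[i] carries no normed R-module structure in the library, so functions of a
   real variable with values in R[i] are differentiated through their real and
   imaginary parts. *)
Definition cderivable (f : R -> R[i]) (x : R) : Prop :=
  derivable (fun y => complex.Re (f y)) x 1 /\
  derivable (fun y => complex.Im (f y)) x 1.

Definition cderive (f : R -> R[i]) (x : R) : R[i] :=
  Complex (derive1 (fun y => complex.Re (f y)) x)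
          (derive1 (fun y => complex.Im (f y)) x).

Section Matrix.
Variables m n : nat.
Implicit Type F : R -> R -> 'M[R[i]]_(m, n).

Definition dx F (x t : R) : 'M[R[i]]_(m, n) :=
  \matrix_(i, j) cderive (fun y => F y t i j) x.

Definition dt F (x t : R) : 'M[R[i]]_(m, n) :=
  \matrix_(i, j) cderive (fun s => F x s i j) t.

Definition continuous2 F : Prop := forall i j,
  continuous (fun z : R * R => complex.Re (F z.1 z.2 i j)) /\
  continuous (fun z : R * R => complex.Im (F z.1 z.2 i j)).

Definition has_partials F : Prop := forall x t i j,
  cderivable (fun y => F y t i j) x /\ cderivable (fun s => F x s i j) t.

(* F is of class C^k on the whole (x, t)-plane. *)
Fixpoint class_C (k : nat) F : Prop :=
  if k is k'.+1 then
    [/\ continuous2 F, has_partials F, class_C k' (dx F) & class_C k' (dt F)]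
  else continuous2 F.

End Matrix.

(* psi |-> i d_x psi + P psi and psi |-> i d_t psi + P psi; psi may be a vector
   or a matrix of solutions. *)
Definition xoper n k (P : R -> R -> 'M[R[i]]_n) (psi : R -> R -> 'M[R[i]]_(n, k))
  (x t : R) : 'M[R[i]]_(n, k) := 'i%C *: dx psi x t + P x t *m psi x t.

Definition toper n k (P : R -> R -> 'M[R[i]]_n) (psi : R -> R -> 'M[R[i]]_(n, k))
  (x t : R) : 'M[R[i]]_(n, k) := 'i%C *: dt psi x t + P x t *m psi x t.

End Calculus.

Section Blocks.
Variables (C : fieldType) (m : nat).

Definition mx3 (a11 : 'M[C]_1) (a12 : 'rV[C]_m) (a13 : 'M[C]_1)
    (a21 : 'cV[C]_m) (a22 : 'M[C]_m) (a23 : 'cV[C]_m)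
    (a31 : 'M[C]_1) (a32 : 'rV[C]_m) (a33 : 'M[C]_1) : 'M[C]_(1 + m + 1) :=
  block_mx (block_mx a11 a12 a21 a22) (col_mx a13 a23) (row_mx a31 a32) a33.

Definition diag3 (a : C) (A : 'M[C]_m) (d : C) : 'M[C]_(1 + m + 1) :=
  mx3 a%:M 0 0  0 A 0  0 0 d%:M.

Definition block_diagonal (M : 'M[C]_(1 + m + 1)) : Prop :=
  exists a A d, M = diag3 a A d.

Definition mx3_12 (M : 'M[C]_(1 + m + 1)) : 'rV[C]_m := ursubmx (ulsubmx M).
Definition mx3_21 (M : 'M[C]_(1 + m + 1)) : 'cV[C]_m := dlsubmx (ulsubmx M).

Definition dot (u v : 'cV[C]_m) : C := (u^T *m v) 0 0.

Definition Jmx : 'M[C]_(1 + m + 1) := diag3 1 0 (-1).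

End Blocks.

(* The middle block has size 2r - 1. *)
Definition mid (r : nat) : nat := (2 * r).-1.

(* Indices are 0-based: entry (i, j) is that of E_{i+1,j+1}, so E_{k,2r-k} is
   selected by (i + 1) + (j + 1) = 2r. *)
Definition s0 (C : fieldType) (r : nat) : 'M[C]_(mid r) :=
  \matrix_(i, j) (if (i.+1 + j.+1 == 2 * r)%N then (-1) ^+ i.+1 else 0).

Section LaxPair.
Variables (R : realType) (r : nat).
Local Notation C := (R[i]).
Local Notation m := (mid r).
Local Notation s := (s0 C r).

Definition Qmx (q p : 'cV[C]_m) : 'M[C]_(1 + m + 1) :=
  mx3 0 q^T 0  p 0 (s *m q)  0 (p^T *m s) 0.

Definition V2mx (q p : 'cV[C]_m) : 'M[C]_(1 + m + 1) :=
  diag3 (dot q p) (s *m q *m p^T *m s - p *m q^T) (- dot q p).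

(* V_3 as a function of (q_x, p_x). *)
Definition V3mx (qx px : 'cV[C]_m) : 'M[C]_(1 + m + 1) :=
  'i%C *: mx3 0 qx^T 0  (- px) 0 (s *m qx)  0 (- (px^T *m s)) 0.

Definition V4_11 (q p qx px : 'cV[C]_m) : C :=
  'i%C * (dot qx p - dot q px) + dot q p ^+ 2
  - 2^-1 * (dot q (s *m q) * dot p (s *m p)).

Definition V4_22 (q p qx px : 'cV[C]_m) : 'M[C]_m :=
  'i%C *: (px *m q^T - p *m qx^T + s *m (qx *m p^T - q *m px^T) *m s)
  - dot q p *: (p *m q^T - s *m q *m p^T *m s).

Definition V4mx (q p qx px : 'cV[C]_m) : 'M[C]_(1 + m + 1) :=
  diag3 (V4_11 q p qx px) (V4_22 q p qx px) (- V4_11 q p qx px).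

Implicit Types q p : R -> R -> 'cV[C]_m.

Definition Qf q p (x t : R) := Qmx (q x t) (p x t).
Definition V2f q p (x t : R) := V2mx (q x t) (p x t).
Definition U2f := V2f.
Definition V3f q p (x t : R) := V3mx (dx q x t) (dx p x t).
Definition V4f q p (x t : R) := V4mx (q x t) (p x t) (dx q x t) (dx p x t).

Definition Lpot q p (lambda : C) (x t : R) : 'M[C]_(1 + m + 1) :=
  U2f q p x t + lambda *: Qf q p x t - lambda ^+ 2 *: Jmx C m.

Definition Mpot q p (lambda : C) (x t : R) : 'M[C]_(1 + m + 1) :=
  V4f q p x t + lambda *: V3f q p x t + lambda ^+ 2 *: V2f q p x t
  + lambda ^+ 3 *: Qf q p x t - lambda ^+ 4 *: Jmx C m.

(* Compatibility of the Lax pair: [L, M] = 0 identically in lambda. *)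
Definition compatible q p : Prop :=
  forall (lambda : C) (psi : R -> R -> 'cV[C]_(1 + m + 1)), class_C 2 psi ->
  forall x t,
    xoper (Lpot q p lambda) (toper (Mpot q p lambda) psi) x t =
    toper (Mpot q p lambda) (xoper (Lpot q p lambda) psi) x t.

(* Block-diagonal elements of the complex orthogonal group of the antidiagonal
   form with blocks 1, -s_0, 1 (the group whose Lie algebra contains J, Q, U_2
   and V_4). *)
Definition gauge_group (h : 'M[C]_(1 + m + 1)) : Prop :=
  exists a A, [/\ a != 0, A^T *m s *m A = s & h = diag3 a A a^-1].

Section Gauged.
Variable g0 : R -> R -> 'M[C]_(1 + m + 1).

Definition gauge (F : R -> R -> 'M[C]_(1 + m + 1)) (x t : R) :
  'M[C]_(1 + m + 1) := g0 x t *m F x t *m invmx (g0 x t).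

Definition gLpot q p (lambda : C) (x t : R) : 'M[C]_(1 + m + 1) :=
  lambda *: gauge (Qf q p) x t - lambda ^+ 2 *: Jmx C m.

Definition gMpot q p (lambda : C) (x t : R) : 'M[C]_(1 + m + 1) :=
  lambda *: gauge (V3f q p) x t + lambda ^+ 2 *: gauge (V2f q p) x t
  + lambda ^+ 3 *: gauge (Qf q p) x t - lambda ^+ 4 *: Jmx C m.

Definition gq q p (x t : R) : 'cV[C]_m := (mx3_12 (gauge (Qf q p) x t))^T.
Definition gp q p (x t : R) : 'cV[C]_m := mx3_21 (gauge (Qf q p) x t).

End Gauged.

(* The cubic terms contract equal vectors with s_0: (q, s_0 q) and (p, s_0 p),
   and the two derivative nonlinearities enter with the same sign. *)
Definition nlee_q q p : Prop := forall x t,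
  'i%C *: dt q x t + dx (dx q) x t
  + 'i%C *: dx (fun y u => (2 * dot (q y u) (p y u)) *: q y u
                 - dot (q y u) (s *m q y u) *: (s *m p y u)) x t = 0.

Definition nlee_p q p : Prop := forall x t,
  'i%C *: dt p x t - dx (dx p) x t
  + 'i%C *: dx (fun y u => (2 * dot (q y u) (p y u)) *: p y u
                 - dot (p y u) (s *m p y u) *: (s *m q y u)) x t = 0.

End LaxPair.

(* Main.v *)
Require Import Defs.
From HB Require Import structures.
From mathcomp Require Import all_boot all_order all_algebra.
From mathcomp Require Import complex ring zify.
From mathcomp Require Import all_classical all_reals all_analysis.

Set Implicit Arguments.
Unset Strict Implicit.
Unset Printing Implicit Defensive.

Import Order.TTheory GRing.Theory Num.Theory.
Import numFieldNormedType.Exports.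

Local Open Scope ring_scope.

(** On C^2 functions the second derivatives in [L, M] cancel, so [L, M] is multiplication by the
    curvature matrix. As the curvature is lambda times a fixed matrix, testing compatibility at
    lambda = 1 on constant vectors recovers everything, and every later step is an equivalence.

    Conjugation by g_0 turns the covariant derivatives i d_x + [U_2, .] and i d_t + [V_4, .] into
    plain i d_x and i d_t. This is why the commutators disappear from the coefficient of lambda and
    the NLEE come out as conservation laws, with a block of V~_3 as flux.

    The obstacle is regularity: g_0 is only assumed C^1. The gauge equations write its derivatives
    as g_0 times C^1 matrices, which makes g_0 C^2; the formula for g_0^{-1} is polynomial in g_0,
    so conjugation preserves C^1 without differentiating an inverse; and the second x-derivatives of
    q~, p~ exist because their first derivatives equal C^1 expressions in V~_3, q~, p~. *)

(* The gauge g_0 preserves the form S = antidiag(1, -s_0, 1), for which U_2 and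
   V_4 are skew, and g_0 J S g_0^T is constant too, both by differentiation;
   hence g_0 stays in the block-diagonal orthogonal group and
   g_0^{-1} = S g_0^T S, with no appeal to uniqueness for linear ODEs.

   The curvature i V_x - i U_t + [U, V] is a polynomial in lambda.  Its
   coefficients of degree 2 to 6 vanish identically, its constant term vanishes
   because g_0 satisfies both gauge equations (equality of mixed partials), so
   compatibility reduces to the coefficient of lambda.  Conjugation by g_0 turns
   that coefficient into i (V~_3)_x - i (Q~)_t, and i Q_x = [J, V_3] into
   i Q~_x = [J, V~_3] + [V~_2, Q~], which expresses V~_3 through q~, p~ and their
   x-derivatives; substituting gives the NLEE. *)

(** * Equality of mixed partial derivatives for real functions on the plane *)

Section RealMixedPartials.
Local Open Scope classical_set_scope.
Variable R : realType.

Lemma mvt_right (f f' : R -> R) (a h : R) : 0 < h ->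
  (forall x : R, is_derive x 1 f (f' x)) ->
  exists2 c, a < c < a + h & f (a + h) - f a = f' c * h.
Proof.
move=> h0 df; have ltah : a < a + h by rewrite ltrDl.
have cf : {within `[a, a + h], continuous f}.
  apply: derivable_within_continuous => x _.
  exact: (@ex_derive _ _ _ _ _ _ _ (df x)).
have [c /itvP cab ->] := MVT ltah (fun x _ => df x) cf.
by exists c; rewrite ?cab // [a + h]addrC addrK.
Qed.

(** Two uses of the mean value theorem: in the first variable for the increment
    [f y (t + h) - f y t], then in the second for [fx c]. The double difference on the left is
    symmetric in the two variables, the right side is not; [mixed_partials] exploits this. *)
Lemma mvt_square (f fx fxt : R -> R -> R) (x t h : R) : 0 < h ->
  (forall x t : R, is_derive x 1 (f ^~ t) (fx x t)) ->
  (forall x t : R, is_derive t 1 (fx x) (fxt x t)) ->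
  exists c d, [/\ x < c < x + h, t < d < t + h &
    f (x + h) (t + h) - f (x + h) t - f x (t + h) + f x t = fxt c d * h * h].
Proof.
move=> h0 dfx dfxt.
have dphi (y : R) : is_derive y 1 (fun y => f y (t + h) - f y t)
    (fx y (t + h) - fx y t).
  by apply: is_deriveB.
have [c cx E] := mvt_right x h0 dphi.
have [d dt' E'] := mvt_right t h0 (dfxt c).
exists c, d; split=> //; rewrite -E' -E; ring.
Qed.

(** If the values differed at a point, continuity would keep each mixed partial within half of the
    gap [e + e] on a small square, while both take the common value of the double difference divided
    by [h ^ 2] somewhere in it. *)
Lemma mixed_partials (f fx ft fxt ftx : R -> R -> R) :
  (forall x t : R, is_derive x 1 (f ^~ t) (fx x t)) ->
  (forall x t : R, is_derive t 1 (f x) (ft x t)) ->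
  (forall x t : R, is_derive t 1 (fx x) (fxt x t)) ->
  (forall x t : R, is_derive x 1 (ft ^~ t) (ftx x t)) ->
  continuous (fun z : R * R => fxt z.1 z.2) ->
  continuous (fun z : R * R => ftx z.1 z.2) ->
  forall x t, fxt x t = ftx x t.
Proof.
move=> dfx dft dfxt dftx cxt ctx x t; apply/eqP/negPn/negP => neq.
pose e := `|fxt x t - ftx x t| / 2.
have e0 : 0 < e by rewrite divr_gt0 // normr_gt0 subr_eq0.
have /cvgrPdist_lt/(_ e e0)/nbhs_ballP[d1 /= d10 H1] := cxt (x, t).
have /cvgrPdist_lt/(_ e e0)/nbhs_ballP[d2 /= d20 H2] := ctx (x, t).
pose h := Num.min d1 d2; have h0 : 0 < h by rewrite lt_min d10.
have [c [d [/andP[c1 c2] /andP[k1 k2] E]]] := mvt_square x t h0 dfx dfxt.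
(* The same square with the variables exchanged, so that the derivative in [t] is taken first. *)
have [d' [c' [/andP[k1' k2'] /andP[c1' c2'] E']]] :=
  @mvt_square (fun t x => f x t) (fun t x => ft x t) (fun t x => ftx x t) t x h h0
    (fun t x => dft x t) (fun t x => dftx x t).
have bxt (u y D : R) : h <= D -> u < y -> y < u + h -> ball u D y.
  by move=> hD uy yu; rewrite /ball /= distrC gtr0_norm ?subr_gt0 // ltrBlDl (lt_le_trans yu) ?lerD2l.
have hd1 : h <= d1 by rewrite ge_min lexx.
have hd2 : h <= d2 by rewrite ge_min lexx orbT.
have {H1} := H1 (c, d) (conj (bxt x _ _ hd1 c1 c2) (bxt t _ _ hd1 k1 k2)).
have {H2} := H2 (c', d') (conj (bxt x _ _ hd2 c1' c2') (bxt t _ _ hd2 k1' k2')).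
have -> : ftx c' d' = fxt c d.
  have hn : h != 0 by rewrite gt_eqF.
  apply: (mulIf hn); apply: (mulIf hn); rewrite -E -E'; ring.
move=> /= H2 H1.
have : `|fxt x t - ftx x t| < e + e.
  rewrite (_ : fxt x t - ftx x t = (fxt x t - fxt c d) - (ftx x t - fxt c d)); last ring.
  by rewrite (le_lt_trans (ler_normB _ _)) // ltrD.
by rewrite /e -splitr ltxx.
Qed.

End RealMixedPartials.

(** * Calculus of complex-valued functions through real and imaginary parts *)

Section ComplexCalculus.
Variable R : realType.
Local Notation C := (R[i]).
Local Notation Re := (@complex.Re R).
Local Notation Im := (@complex.Im R).
Implicit Types (f g : R -> C) (a b : C).

Let ReD a b : Re (a + b) = Re a + Re b. Proof. by case: a b => [? ?] []. Qed.
Let ImD a b : Im (a + b) = Im a + Im b. Proof. by case: a b => [? ?] []. Qed.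
Let ReM a b : Re (a * b) = Re a * Re b - Im a * Im b.
Proof. by case: a b => [? ?] []. Qed.
Let ImM a b : Im (a * b) = Re a * Im b + Im a * Re b.
Proof. by case: a b => [? ?] []. Qed.

Lemma complex_ext a b : Re a = Re b -> Im a = Im b -> a = b.
Proof. by case: a b => [? ?] [? ?] /= -> ->. Qed.

(** A relation that carries existence together with the value, so that the differentiation rules
    compose; [cderive] is total and has a value even where [f] is not differentiable. *)
Definition is_cderive (x : R) f a : Prop :=
  is_derive x 1 (fun y => Re (f y)) (Re a) /\
  is_derive x 1 (fun y => Im (f y)) (Im a).

Lemma cderivableP f x : cderivable f x -> is_cderive x f (cderive f x).
Proof.
by move=> [dr di]; split; [apply: (DeriveDef dr)|apply: (DeriveDef di)]; rewrite /= derive1E.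
Qed.

Lemma is_cderive_cderive f x a : is_cderive x f a -> cderive f x = a.
Proof.
by case: a => u v [[_ /= dr] [_ /= di]]; rewrite /cderive !derive1E dr di.
Qed.

Lemma is_cderive_cderivable f x a : is_cderive x f a -> cderivable f x.
Proof. by move=> [[dr _] [di _]]; exact: conj dr di. Qed.

Lemma is_cderive_cst x a : is_cderive x (fun=> a) 0.
Proof. by split; exact: is_derive_cst. Qed.

Lemma is_cderiveD x f g a b : is_cderive x f a -> is_cderive x g b ->
  is_cderive x (fun y => f y + g y) (a + b).
Proof.
move=> [fr fi] [gr gi]; split.
  by rewrite ReD; under eq_fun do rewrite ReD; exact: is_deriveD.
by rewrite ImD; under eq_fun do rewrite ImD; exact: is_deriveD.
Qed.

Lemma is_cderiveM x f g a b : is_cderive x f a -> is_cderive x g b ->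
  is_cderive x (fun y => f y * g y) (a * g x + f x * b).
Proof.
move=> [fr fi] [gr gi]; split.
(* The value is rearranged into the shape that [is_deriveM] produces, [f x *: b + g x *: a]. *)
- rewrite (_ : Re _ = (Re (f x) *: Re b + Re (g x) *: Re a) -
                      (Im (f x) *: Im b + Im (g x) *: Im a)); last first.
    by rewrite ReD !ReM /GRing.scale /=; ring.
  under eq_fun do rewrite ReM.
  exact: is_deriveB (is_deriveM fr gr) (is_deriveM fi gi).
- rewrite (_ : Im _ = (Re (f x) *: Im b + Im (g x) *: Re a) +
                      (Im (f x) *: Re b + Re (g x) *: Im a)); last first.
    by rewrite ImD !ImM /GRing.scale /=; ring.
  under eq_fun do rewrite ImM.
  exact: is_deriveD (is_deriveM fr gi) (is_deriveM fi gr).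
Qed.

Lemma is_cderive_sum x (I : Type) (s : seq I) (F : I -> R -> C) (D : I -> C) :
  (forall i, is_cderive x (F i) (D i)) ->
  is_cderive x (fun y => \sum_(i <- s) F i y) (\sum_(i <- s) D i).
Proof.
move=> dF; elim: s => [|i s IH].
  rewrite big_nil (_ : (fun y => _) = (fun=> 0)); first exact: is_cderive_cst.
  by apply/funext => y; rewrite big_nil.
rewrite big_cons (_ : (fun y => _) = (fun y => F i y + \sum_(j <- s) F j y)).
  exact: is_cderiveD.
by apply/funext => y; rewrite big_cons.
Qed.

Lemma cderive0_cst f : (forall x, is_cderive x f 0) -> forall x y, f x = f y.
Proof.
move=> df x y.
apply: complex_ext.
  exact: is_derive_0_is_cst (fun x => (df x).1).
exact: is_derive_0_is_cst (fun x => (df x).2).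
Qed.

Definition ccontinuous (f : R * R -> C) : Prop :=
  continuous (fun z => Re (f z)) /\ continuous (fun z => Im (f z)).

Lemma ccontinuous_cst a : ccontinuous (fun=> a).
Proof. by split=> z; exact: cvg_cst. Qed.

Lemma ccontinuousD (f g : R * R -> C) : ccontinuous f -> ccontinuous g ->
  ccontinuous (fun z => f z + g z).
Proof.
move=> [fr fi] [gr gi]; split=> z.
  under eq_fun do rewrite ReD.
  by apply: cvgD; [exact: fr|exact: gr].
under eq_fun do rewrite ImD.
by apply: cvgD; [exact: fi|exact: gi].
Qed.

Lemma ccontinuousM (f g : R * R -> C) : ccontinuous f -> ccontinuous g ->
  ccontinuous (fun z => f z * g z).
Proof.
move=> [fr fi] [gr gi]; split=> z.
  under eq_fun do rewrite ReM.
  by apply: cvgB; apply: cvgM; [exact: fr|exact: gr|exact: fi|exact: gi].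
under eq_fun do rewrite ImM.
by apply: cvgD; apply: cvgM; [exact: fr|exact: gi|exact: fi|exact: gr].
Qed.

Lemma ccontinuous_sum (I : Type) (s : seq I) (F : I -> R * R -> C) :
  (forall i, ccontinuous (F i)) -> ccontinuous (fun z => \sum_(i <- s) F i z).
Proof.
move=> cF; elim: s => [|i s IH].
  rewrite (_ : (fun z => _) = (fun=> 0)); first exact: ccontinuous_cst.
  by apply/funext => z; rewrite big_nil.
rewrite (_ : (fun z => _) = (fun z => F i z + \sum_(j <- s) F j z)).
  exact: ccontinuousD.
by apply/funext => z; rewrite big_cons.
Qed.

End ComplexCalculus.

(** * Entrywise differentiation of matrix-valued functions of one real variable *)

Section MatrixDerivative.
Variable R : realType.
Local Notation C := (R[i]).

Definition is_mderive m n (x : R) (F : R -> 'M[C]_(m, n)) (D : 'M[C]_(m, n)) :=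
  forall i j, is_cderive x (fun y => F y i j) (D i j).

Lemma is_mderive_cst m n x (A : 'M[C]_(m, n)) : is_mderive x (fun=> A) 0.
Proof. by move=> i j; rewrite mxE; exact: is_cderive_cst. Qed.

Lemma is_mderiveD m n x (F G : R -> 'M[C]_(m, n)) F' G' :
  is_mderive x F F' -> is_mderive x G G' ->
  is_mderive x (fun y => F y + G y) (F' + G').
Proof.
move=> dF dG i j; under eq_fun do rewrite mxE.
by rewrite mxE; exact: is_cderiveD.
Qed.

Lemma is_mderiveM m n k x (F : R -> 'M[C]_(m, n)) (G : R -> 'M[C]_(n, k)) F' G' :
  is_mderive x F F' -> is_mderive x G G' ->
  is_mderive x (fun y => F y *m G y) (F' *m G x + F x *m G').
Proof.
move=> dF dG i j; under eq_fun do rewrite mxE.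
rewrite !mxE -big_split /=.
by apply: is_cderive_sum => l; exact: is_cderiveM.
Qed.

Lemma is_mderiveZ m n x (c : C) (F : R -> 'M[C]_(m, n)) F' :
  is_mderive x F F' -> is_mderive x (fun y => c *: F y) (c *: F').
Proof.
move=> dF i j; under eq_fun do rewrite mxE.
rewrite mxE -[_ * _]add0r -(mul0r (F x i j)).
by apply: is_cderiveM => //; exact: is_cderive_cst.
Qed.

Lemma is_mderiveN m n x (F : R -> 'M[C]_(m, n)) F' :
  is_mderive x F F' -> is_mderive x (fun y => - F y) (- F').
Proof.
move=> /(is_mderiveZ (-1)); rewrite scaleN1r.
by under eq_fun do rewrite scaleN1r.
Qed.

Lemma is_mderiveB m n x (F G : R -> 'M[C]_(m, n)) F' G' :
  is_mderive x F F' -> is_mderive x G G' ->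
  is_mderive x (fun y => F y - G y) (F' - G').
Proof. by move=> dF /is_mderiveN; exact: is_mderiveD. Qed.

Lemma is_mderive_tr m n x (F : R -> 'M[C]_(m, n)) F' :
  is_mderive x F F' -> is_mderive x (fun y => (F y)^T) F'^T.
Proof. by move=> dF i j; under eq_fun do rewrite mxE; rewrite mxE. Qed.

Lemma is_mderive_row_mx m n1 n2 x (F : R -> 'M[C]_(m, n1)) (G : R -> 'M[C]_(m, n2))
    F' G' : is_mderive x F F' -> is_mderive x G G' ->
  is_mderive x (fun y => row_mx (F y) (G y)) (row_mx F' G').
Proof.
move=> dF dG i j; rewrite -[j]splitK; case: (fintype.split j) => k /=.
  by rewrite row_mxEl; under eq_fun do rewrite row_mxEl.
by rewrite row_mxEr; under eq_fun do rewrite row_mxEr.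
Qed.

Lemma is_mderive_col_mx m1 m2 n x (F : R -> 'M[C]_(m1, n)) (G : R -> 'M[C]_(m2, n))
    F' G' : is_mderive x F F' -> is_mderive x G G' ->
  is_mderive x (fun y => col_mx (F y) (G y)) (col_mx F' G').
Proof.
move=> dF dG k j; rewrite -[k]splitK; case: (fintype.split k) => {}k /=.
  by rewrite col_mxEu; under eq_fun do rewrite col_mxEu.
by rewrite col_mxEd; under eq_fun do rewrite col_mxEd.
Qed.

Lemma is_mderive_block m1 m2 n1 n2 x (A : R -> 'M[C]_(m1, n1)) (B : R -> 'M[C]_(m1, n2))
    (D : R -> 'M[C]_(m2, n1)) (E : R -> 'M[C]_(m2, n2)) A' B' D' E' :
  is_mderive x A A' -> is_mderive x B B' -> is_mderive x D D' -> is_mderive x E E' ->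
  is_mderive x (fun y => block_mx (A y) (B y) (D y) (E y)) (block_mx A' B' D' E').
Proof. by move=> *; apply: is_mderive_col_mx; exact: is_mderive_row_mx. Qed.

Lemma mderive0_cst m n (F : R -> 'M[C]_(m, n)) :
  (forall x, is_mderive x F 0) -> forall x y, F x = F y.
Proof.
move=> dF x y; apply/matrixP => i j.
by apply: (cderive0_cst (f := fun y => F y i j)) => z; have := dF z i j; rewrite mxE.
Qed.

End MatrixDerivative.

(** * Closure properties of the classes C^k, and equality of mixed partials for matrices *)

Section ClassC.
Variable R : realType.
Local Notation C := (R[i]).

Lemma dxE m n (F : R -> R -> 'M[C]_(m, n)) x t D :
  is_mderive x (F ^~ t) D -> dx F x t = D.
Proof. by move=> dF; apply/matrixP => i j; rewrite mxE (is_cderive_cderive (dF i j)). Qed.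

Lemma dtE m n (F : R -> R -> 'M[C]_(m, n)) x t D :
  is_mderive t (F x) D -> dt F x t = D.
Proof. by move=> dF; apply/matrixP => i j; rewrite mxE (is_cderive_cderive (dF i j)). Qed.

Lemma has_partialsP m n (F : R -> R -> 'M[C]_(m, n)) : has_partials F <->
  forall x t, is_mderive x (F ^~ t) (dx F x t) /\ is_mderive t (F x) (dt F x t).
Proof.
split=> [pF x t|dF x t i j].
  by split=> i j; rewrite mxE; apply: cderivableP; case: (pF x t i j).
have [dFx dFt] := dF x t.
by split; [exact: is_cderive_cderivable (dFx i j)|exact: is_cderive_cderivable (dFt i j)].
Qed.

Lemma has_partials_from m n (F Fx Ft : R -> R -> 'M[C]_(m, n)) :
  (forall x t, is_mderive x (F ^~ t) (Fx x t)) ->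
  (forall x t, is_mderive t (F x) (Ft x t)) ->
  [/\ has_partials F, dx F = Fx & dt F = Ft].
Proof.
move=> dFx dFt.
have ex : dx F = Fx by apply/funext => x; apply/funext => t; exact: dxE.
have et : dt F = Ft by apply/funext => x; apply/funext => t; exact: dtE.
by split=> //; apply/has_partialsP => x t; rewrite ex et.
Qed.

(** Partial derivatives may be supplied as explicit formulas: extensionality identifies them with
    [dx F] and [dt F], and this drives the inductions on [k] below. *)
Lemma class_C_from k m n (F Fx Ft : R -> R -> 'M[C]_(m, n)) :
  continuous2 F ->
  (forall x t, is_mderive x (F ^~ t) (Fx x t)) ->
  (forall x t, is_mderive t (F x) (Ft x t)) ->
  class_C k Fx -> class_C k Ft -> class_C k.+1 F.
Proof.
by move=> cF dFx dFt cx ct; have [pF ex et] := has_partials_from dFx dFt; rewrite /= ex et.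
Qed.

Lemma class_C_continuous k m n (F : R -> R -> 'M[C]_(m, n)) :
  class_C k F -> continuous2 F.
Proof. by case: k => [//|k []]. Qed.

Lemma class_C_pred k m n (F : R -> R -> 'M[C]_(m, n)) : class_C k.+1 F -> class_C k F.
Proof.
elim: k F => [|k IH] F [cF pF cx ct]; first exact: cF.
by split; [exact: cF|exact: pF|exact: IH cx|exact: IH ct].
Qed.

Lemma class_C_derx k m n (F : R -> R -> 'M[C]_(m, n)) x t :
  class_C k.+1 F -> is_mderive x (F ^~ t) (dx F x t).
Proof. by move=> [_ /has_partialsP/(_ x t)[]]. Qed.

Lemma class_C_dert k m n (F : R -> R -> 'M[C]_(m, n)) x t :
  class_C k.+1 F -> is_mderive t (F x) (dt F x t).
Proof. by move=> [_ /has_partialsP/(_ x t)[]]. Qed.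

Lemma class_C_dx k m n (F : R -> R -> 'M[C]_(m, n)) : class_C k.+1 F -> class_C k (dx F).
Proof. by case. Qed.

Lemma class_C_dt k m n (F : R -> R -> 'M[C]_(m, n)) : class_C k.+1 F -> class_C k (dt F).
Proof. by case. Qed.

Lemma class_C_cst k m n (A : 'M[C]_(m, n)) : class_C k (fun _ _ => A).
Proof.
elim: k m n A => [|k IH] m n A; first by move=> i j; exact: ccontinuous_cst.
apply: (@class_C_from _ _ _ _ (fun _ _ => 0) (fun _ _ => 0)) => //.
- by move=> i j; exact: ccontinuous_cst.
- by move=> x t; exact: is_mderive_cst.
- by move=> x t; exact: is_mderive_cst.
Qed.

Lemma class_CD k m n (F G : R -> R -> 'M[C]_(m, n)) :
  class_C k F -> class_C k G -> class_C k (fun x t => F x t + G x t).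
Proof.
have c0 (F' G' : R -> R -> 'M[C]_(m, n)) : continuous2 F' -> continuous2 G' ->
    continuous2 (fun x t => F' x t + G' x t).
  move=> cF cG i j; have [hr hi] := ccontinuousD (cF i j) (cG i j).
  by split; under eq_fun do rewrite mxE; [exact: hr|exact: hi].
elim: k F G => [|k IH] F G cF cG; first exact: c0.
apply: (@class_C_from _ _ _ _ (fun x t => dx F x t + dx G x t)
                              (fun x t => dt F x t + dt G x t)).
- by apply: c0; [exact: class_C_continuous cF|exact: class_C_continuous cG].
- by move=> x t; apply: is_mderiveD; [exact: class_C_derx cF|exact: class_C_derx cG].
- by move=> x t; apply: is_mderiveD; [exact: class_C_dert cF|exact: class_C_dert cG].
- by apply: IH; apply: class_C_dx.
- by apply: IH; apply: class_C_dt.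
Qed.

Lemma class_CM k m n l (F : R -> R -> 'M[C]_(m, n)) (G : R -> R -> 'M[C]_(n, l)) :
  class_C k F -> class_C k G -> class_C k (fun x t => F x t *m G x t).
Proof.
have c0 (F' : R -> R -> 'M[C]_(m, n)) (G' : R -> R -> 'M[C]_(n, l)) :
    continuous2 F' -> continuous2 G' -> continuous2 (fun x t => F' x t *m G' x t).
  move=> cF cG i j.
  have [hr hi] := ccontinuous_sum (index_enum 'I_n)
    (fun a => ccontinuousM (cF i a) (cG a j)).
  by split; under eq_fun do rewrite mxE; [exact: hr|exact: hi].
elim: k F G => [|k IH] F G cF cG; first exact: c0.
(* The product rule leaves undifferentiated factors, so the induction hypothesis is also needed for
   [F] and [G] themselves, one class lower. *)
have [cF' cG'] := (class_C_pred cF, class_C_pred cG).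
apply: (@class_C_from _ _ _ _ (fun x t => dx F x t *m G x t + F x t *m dx G x t)
                              (fun x t => dt F x t *m G x t + F x t *m dt G x t)).
- by apply: c0; [exact: class_C_continuous cF|exact: class_C_continuous cG].
- by move=> x t; apply: is_mderiveM; [exact: class_C_derx cF|exact: class_C_derx cG].
- by move=> x t; apply: is_mderiveM; [exact: class_C_dert cF|exact: class_C_dert cG].
- by apply: class_CD; apply: IH => //; apply: class_C_dx.
- by apply: class_CD; apply: IH => //; apply: class_C_dt.
Qed.

Lemma class_CZ k m n (c : C) (F : R -> R -> 'M[C]_(m, n)) :
  class_C k F -> class_C k (fun x t => c *: F x t).
Proof.
move=> cF; have := class_CM (class_C_cst k c%:M) cF.
by congr class_C; apply/funext => x; apply/funext => t; rewrite mul_scalar_mx.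
Qed.

Lemma class_CN k m n (F : R -> R -> 'M[C]_(m, n)) :
  class_C k F -> class_C k (fun x t => - F x t).
Proof.
move=> /(class_CZ (-1)).
by congr class_C; apply/funext => x; apply/funext => t; rewrite scaleN1r.
Qed.

Lemma class_CB k m n (F G : R -> R -> 'M[C]_(m, n)) :
  class_C k F -> class_C k G -> class_C k (fun x t => F x t - G x t).
Proof. by move=> cF /class_CN; exact: class_CD. Qed.

Lemma class_C_tr k m n (F : R -> R -> 'M[C]_(m, n)) :
  class_C k F -> class_C k (fun x t => (F x t)^T).
Proof.
have c0 (F' : R -> R -> 'M[C]_(m, n)) : continuous2 F' ->
    continuous2 (fun x t => (F' x t)^T).
  by move=> cF i j; have [hr hi] := cF j i; split; under eq_fun do rewrite mxE; [exact: hr|exact: hi].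
elim: k F => [|k IH] F cF; first exact: c0.
apply: (@class_C_from _ _ _ _ (fun x t => (dx F x t)^T) (fun x t => (dt F x t)^T)).
- by apply: c0; exact: class_C_continuous cF.
- by move=> x t; apply: is_mderive_tr; exact: class_C_derx cF.
- by move=> x t; apply: is_mderive_tr; exact: class_C_dert cF.
- by apply: IH; apply: class_C_dx.
- by apply: IH; apply: class_C_dt.
Qed.

(** Assembling blocks is a sum of products with constant matrices, so closure under sums and
    products suffices without a new induction. Extraction of submatrices is treated in the same way,
    with transposition exchanging rows and columns. *)
Lemma class_C_row_mx k m n1 n2 (F : R -> R -> 'M[C]_(m, n1)) (G : R -> R -> 'M[C]_(m, n2)) :
  class_C k F -> class_C k G -> class_C k (fun x t => row_mx (F x t) (G x t)).
Proof.
move=> cF cG.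
have := class_CD (class_CM cF (class_C_cst k (row_mx 1%:M 0)))
                 (class_CM cG (class_C_cst k (row_mx 0 1%:M))).
congr class_C; apply/funext => x; apply/funext => t.
by rewrite !mul_mx_row !mulmx1 !mulmx0 add_row_mx addr0 add0r.
Qed.

Lemma class_C_col_mx k m1 m2 n (F : R -> R -> 'M[C]_(m1, n)) (G : R -> R -> 'M[C]_(m2, n)) :
  class_C k F -> class_C k G -> class_C k (fun x t => col_mx (F x t) (G x t)).
Proof.
move=> /class_C_tr cF /class_C_tr cG.
have := class_C_tr (class_C_row_mx cF cG).
by congr class_C; apply/funext => x; apply/funext => t; rewrite tr_row_mx !trmxK.
Qed.

Lemma class_C_block k m1 m2 n1 n2 (A : R -> R -> 'M[C]_(m1, n1)) (B : R -> R -> 'M[C]_(m1, n2))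
    (D : R -> R -> 'M[C]_(m2, n1)) (E : R -> R -> 'M[C]_(m2, n2)) :
  class_C k A -> class_C k B -> class_C k D -> class_C k E ->
  class_C k (fun x t => block_mx (A x t) (B x t) (D x t) (E x t)).
Proof. by move=> *; apply: class_C_col_mx; apply: class_C_row_mx. Qed.

Lemma class_C_lsubmx k m n1 n2 (F : R -> R -> 'M[C]_(m, n1 + n2)) :
  class_C k F -> class_C k (fun x t => lsubmx (F x t)).
Proof.
move=> cF; have := class_CM cF (class_C_cst k (col_mx 1%:M 0)).
congr class_C; apply/funext => x; apply/funext => t.
by rewrite -{1}[F x t]hsubmxK mul_row_col mulmx1 mulmx0 addr0.
Qed.

Lemma class_C_rsubmx k m n1 n2 (F : R -> R -> 'M[C]_(m, n1 + n2)) :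
  class_C k F -> class_C k (fun x t => rsubmx (F x t)).
Proof.
move=> cF; have := class_CM cF (class_C_cst k (col_mx 0 1%:M)).
congr class_C; apply/funext => x; apply/funext => t.
by rewrite -{1}[F x t]hsubmxK mul_row_col mulmx1 mulmx0 add0r.
Qed.

Lemma class_C_usubmx k m1 m2 n (F : R -> R -> 'M[C]_(m1 + m2, n)) :
  class_C k F -> class_C k (fun x t => usubmx (F x t)).
Proof.
move=> /class_C_tr/class_C_lsubmx/class_C_tr.
by congr class_C; apply/funext => x; apply/funext => t; rewrite -trmx_usub trmxK.
Qed.

Lemma class_C_dsubmx k m1 m2 n (F : R -> R -> 'M[C]_(m1 + m2, n)) :
  class_C k F -> class_C k (fun x t => dsubmx (F x t)).
Proof.
move=> /class_C_tr/class_C_rsubmx/class_C_tr.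
by congr class_C; apply/funext => x; apply/funext => t; rewrite -trmx_dsub trmxK.
Qed.

Lemma dt_dx m n (F : R -> R -> 'M[C]_(m, n)) : class_C 2 F ->
  forall x t, dt (dx F) x t = dx (dt F) x t.
Proof.
move=> cF x t; apply/matrixP => i j.
have [cx ct] := (class_C_dx cF, class_C_dt cF).
have h1 x' t' := class_C_derx x' t' cF i j.
have h2 x' t' := class_C_dert x' t' cF i j.
have h3 x' t' := class_C_dert x' t' cx i j.
have h4 x' t' := class_C_derx x' t' ct i j.
have [c1 c2] := class_C_continuous (class_C_dt cx) i j.
have [c3 c4] := class_C_continuous (class_C_dx ct) i j.
apply: complex_ext.
  exact: mixed_partials (fun x t => (h1 x t).1) (fun x t => (h2 x t).1)
    (fun x t => (h3 x t).1) (fun x t => (h4 x t).1) c1 c3 x t.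
exact: mixed_partials (fun x t => (h1 x t).2) (fun x t => (h2 x t).2)
  (fun x t => (h3 x t).2) (fun x t => (h4 x t).2) c2 c4 x t.
Qed.

End ClassC.

(** * Algebra of 3 by 3 block matrices and the centraliser of [J] *)

Section Mx3.
Variables (C : fieldType) (m : nat).
Implicit Types (M : 'M[C]_(1 + m + 1)).

Lemma addmxE k l (A B : 'M[C]_(k, l)) i j : (A + B) i j = A i j + B i j.
Proof. by rewrite mxE. Qed.

Lemma oppmxE k l (A : 'M[C]_(k, l)) i j : (- A) i j = - A i j.
Proof. by rewrite mxE. Qed.

Lemma scalemxE k l c (A : 'M[C]_(k, l)) i j : (c *: A) i j = c * A i j.
Proof. by rewrite mxE. Qed.

Lemma zeromxE k l i j : (0 : 'M[C]_(k, l)) i j = 0.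
Proof. by rewrite mxE. Qed.

Lemma mx3_add a11 a12 a13 a21 a22 a23 a31 a32 a33
              b11 b12 b13 b21 b22 b23 b31 b32 b33 :
  @mx3 C m a11 a12 a13 a21 a22 a23 a31 a32 a33 +
  mx3 b11 b12 b13 b21 b22 b23 b31 b32 b33 =
  mx3 (a11 + b11) (a12 + b12) (a13 + b13) (a21 + b21) (a22 + b22) (a23 + b23)
      (a31 + b31) (a32 + b32) (a33 + b33).
Proof. by rewrite /mx3 !add_block_mx add_col_mx add_row_mx. Qed.

Lemma mx3_scale c a11 a12 a13 a21 a22 a23 a31 a32 a33 :
  c *: @mx3 C m a11 a12 a13 a21 a22 a23 a31 a32 a33 =
  mx3 (c *: a11) (c *: a12) (c *: a13) (c *: a21) (c *: a22) (c *: a23)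
      (c *: a31) (c *: a32) (c *: a33).
Proof. by rewrite /mx3 !scale_block_mx scale_col_mx scale_row_mx. Qed.

Lemma mx3_opp a11 a12 a13 a21 a22 a23 a31 a32 a33 :
  - @mx3 C m a11 a12 a13 a21 a22 a23 a31 a32 a33 =
  mx3 (- a11) (- a12) (- a13) (- a21) (- a22) (- a23) (- a31) (- a32) (- a33).
Proof. by rewrite /mx3 !opp_block_mx opp_col_mx opp_row_mx. Qed.

Lemma mx3_tr a11 a12 a13 a21 a22 a23 a31 a32 a33 :
  (@mx3 C m a11 a12 a13 a21 a22 a23 a31 a32 a33)^T =
  mx3 a11^T a21^T a31^T a12^T a22^T a32^T a13^T a23^T a33^T.
Proof. by rewrite /mx3 !tr_block_mx tr_col_mx tr_row_mx. Qed.

Lemma mx3_mul a11 a12 a13 a21 a22 a23 a31 a32 a33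
              b11 b12 b13 b21 b22 b23 b31 b32 b33 :
  @mx3 C m a11 a12 a13 a21 a22 a23 a31 a32 a33 *m
  mx3 b11 b12 b13 b21 b22 b23 b31 b32 b33 =
  mx3 (a11 *m b11 + a12 *m b21 + a13 *m b31)
      (a11 *m b12 + a12 *m b22 + a13 *m b32)
      (a11 *m b13 + a12 *m b23 + a13 *m b33)
      (a21 *m b11 + a22 *m b21 + a23 *m b31)
      (a21 *m b12 + a22 *m b22 + a23 *m b32)
      (a21 *m b13 + a22 *m b23 + a23 *m b33)
      (a31 *m b11 + a32 *m b21 + a33 *m b31)
      (a31 *m b12 + a32 *m b22 + a33 *m b32)
      (a31 *m b13 + a32 *m b23 + a33 *m b33).
Proof.
rewrite /mx3 !mulmx_block !mul_col_row !mul_block_col !mul_row_block !mul_col_mx.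
by rewrite !mul_row_col !mul_mx_row add_block_mx add_col_mx add_row_mx.
Qed.

Lemma mx3_inj a11 a12 a13 a21 a22 a23 a31 a32 a33
              b11 b12 b13 b21 b22 b23 b31 b32 b33 :
  @mx3 C m a11 a12 a13 a21 a22 a23 a31 a32 a33 =
  mx3 b11 b12 b13 b21 b22 b23 b31 b32 b33 ->
  [/\ a11 = b11, a12 = b12 & a13 = b13] /\
  [/\ a21 = b21, a22 = b22 & a23 = b23] /\
  [/\ a31 = b31, a32 = b32 & a33 = b33].
Proof. by move=> /eq_block_mx[/eq_block_mx[-> -> -> ->] /eq_col_mx[-> ->] /eq_row_mx[-> ->] ->]. Qed.

Lemma mx3P M : exists a11 a12 a13 a21 a22 a23 a31 a32 a33,
  M = mx3 a11 a12 a13 a21 a22 a23 a31 a32 a33.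
Proof.
exists (ulsubmx (ulsubmx M)), (mx3_12 M), (usubmx (ursubmx M)).
exists (mx3_21 M), (drsubmx (ulsubmx M)), (dsubmx (ursubmx M)).
exists (lsubmx (dlsubmx M)), (rsubmx (dlsubmx M)), (drsubmx M).
by rewrite /mx3 /mx3_12 /mx3_21 vsubmxK hsubmxK !submxK.
Qed.

Lemma mx3_12E a11 a12 a13 a21 a22 a23 a31 a32 a33 :
  mx3_12 (@mx3 C m a11 a12 a13 a21 a22 a23 a31 a32 a33) = a12.
Proof. by rewrite /mx3_12 /mx3 block_mxKul block_mxKur. Qed.

Lemma mx3_21E a11 a12 a13 a21 a22 a23 a31 a32 a33 :
  mx3_21 (@mx3 C m a11 a12 a13 a21 a22 a23 a31 a32 a33) = a21.
Proof. by rewrite /mx3_21 /mx3 block_mxKul block_mxKdl. Qed.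

Lemma diag3_mul a (A : 'M[C]_m) d b B e :
  diag3 a A d *m diag3 b B e = diag3 (a * b) (A *m B) (d * e).
Proof. by rewrite /diag3 mx3_mul !(mul0mx, mulmx0, addr0, add0r) -!scalar_mxM. Qed.

Lemma diag3_1 : diag3 1 1%:M 1 = 1%:M :> 'M[C]_(1 + m + 1).
Proof. by rewrite /diag3 /mx3 col_mx0 row_mx0 -!scalar_mx_block. Qed.

Lemma diag3_J a A d : diag3 a A d *m Jmx C m = Jmx C m *m diag3 a A d.
Proof. by rewrite !diag3_mul mulmx0 mul0mx mul1r mulr1 mulrC. Qed.

(** The diagonal scalars 1, 0, -1 of [J] are pairwise distinct once 2 is nonzero, so its centraliser
    is block-diagonal. The hypothesis on 2 serves the two corner blocks, which satisfy [- A = A]. *)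
Lemma commJ_diag M : 2 != 0 :> C -> M *m Jmx C m = Jmx C m *m M -> block_diagonal M.
Proof.
move=> n2; have [a11 [a12 [a13 [a21 [a22 [a23 [a31 [a32 [a33 ->]]]]]]]]] := mx3P M.
have opp0 k l (A : 'M[C]_(k, l)) : - A = A -> A = 0.
  move=> e; apply/matrixP => i j; have := congr1 (fun B : 'M[C]_(k, l) => B i j) e.
  rewrite !mxE => {}e; apply: (mulfI n2); rewrite mulr0 mulr_natl mulr2n -{1}e.
  exact: addNr.
rewrite /Jmx /diag3 !mx3_mul !(mul0mx, mulmx0, addr0, add0r).
rewrite !(mul_mx_scalar, mul_scalar_mx) !(scale1r, scaleN1r).
move=> /mx3_inj [[_ e12 /opp0 ->] [[-> _ e23] [/esym/opp0 -> e32 _]]].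
have -> : a23 = 0 by rewrite -[a23]opprK e23 oppr0.
have -> : a32 = 0 by rewrite -[a32]opprK -e32 oppr0.
rewrite -e12.
by exists (a11 0 0), a22, (a33 0 0); rewrite /diag3 -!mx11_scalar.
Qed.

End Mx3.

Ltac mxring := apply/matrixP => ? ?; rewrite !(addmxE, oppmxE, scalemxE, zeromxE); ring.

(** * The matrix [s0], the invariant form, and its skew matrices *)

Section Orthogonal.
Variables (C : fieldType) (r : nat).
Local Notation m := (mid r).
Local Notation s := (s0 C r).

(** At a nonzero entry the 1-based indices sum to [2 * r], hence have equal parity, and the signs at
    mirrored positions agree. *)
Lemma s0_tr : s^T = s.
Proof.
apply/matrixP => i j; rewrite !mxE [in LHS]addnC; case: ifP => // /eqP e.
rewrite -[LHS]signr_odd -[RHS]signr_odd; congr (_ ^+ nat_of_bool _).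
have := congr1 odd e; rewrite oddD mul2n odd_double.
by case: (odd i.+1); case: (odd j.+1).
Qed.

Lemma s0_sqr : s *m s = 1%:M.
Proof.
apply/matrixP => i j; rewrite !mxE.
have nat_k (a b N : nat) : (a.+1 + b.+1 = N -> b = N - a.+2)%N by lia.
have hi : (i < (2 * r).-1)%N := ltn_ord i.
have hj : (j < (2 * r).-1)%N := ltn_ord j.
(* The 0-based column of the only nonzero entry of row [i], from [i.+1 + k.+1 = 2 * r]. The two
   signs met then multiply to [(-1) ^+ (2 * r)]. *)
have ki : (2 * r - i.+2 < (2 * r).-1)%N by lia.
rewrite (bigD1 (Ordinal ki)) //= big1 ?addr0; last first.
  move=> k nk; rewrite !mxE; case: ifP; rewrite ?mul0r // => /eqP e.
  case/eqP: nk; apply: val_inj => /=; exact: nat_k e.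
rewrite !mxE /=.
have -> : (i.+1 + (2 * r - i.+2).+1 == 2 * r)%N by apply/eqP; lia.
have -> : ((2 * r - i.+2).+1 + j.+1 == 2 * r)%N = (i == j).
  by rewrite -val_eqE /=; apply/eqP/eqP; lia.
case: eqP => _; last by rewrite mulr0.
rewrite -exprD; have -> : (i.+1 + (2 * r - i.+2).+1 = 2 * r)%N by lia.
by rewrite exprM sqrrN !expr1n.
Qed.

(** The form S. The sign of its middle block is the one that makes [Q] skew as well: Q S + S Q^T =
    0. *)
Definition bform : 'M[C]_(1 + m + 1) := mx3 0 0 1%:M  0 (- s) 0  1%:M 0 0.

Lemma bform_sqr : bform *m bform = 1%:M.
Proof.
rewrite /bform mx3_mul !(mul0mx, mulmx0, addr0, add0r, mulmx1) mulmxN mulNmx opprK s0_sqr.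
by rewrite -diag3_1.
Qed.

Lemma diag3_form_tr a (A : 'M[C]_m) d b B e :
  diag3 a A d *m bform *m (diag3 b B e)^T =
  mx3 0 0 (a * e)%:M  0 (- (A *m s *m B^T)) 0  (d * b)%:M 0 0.
Proof.
rewrite /bform /diag3 mx3_tr !mx3_mul !trmx0 !(mul0mx, mulmx0, addr0, add0r, mulmx1, tr_scalar_mx).
by rewrite mulmxN mulNmx !scalar_mxM.
Qed.

(** The opposite corners [a] and [- a] cancel, which leaves the condition on the middle block. *)
Lemma skew_form a (A : 'M[C]_m) : A *m s + s *m A^T = 0 ->
  diag3 a A (- a) *m bform + bform *m (diag3 a A (- a))^T = 0.
Proof.
move=> eA; rewrite /bform /diag3 mx3_tr !mx3_mul !trmx0.
rewrite !(mul0mx, mulmx0, addr0, add0r, mulmx1, mul1mx, tr_scalar_mx).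
rewrite mx3_add mulmxN mulNmx -opprD eA !addr0 oppr0 -!raddfD /= addrN addNr raddf0.
by rewrite /mx3 !(col_mx0, row_mx0) /block_mx !(col_mx0, row_mx0).
Qed.

(** [X] minus its adjoint [s *m X^T *m s] is skew for the form [s]. The middle blocks of U_2 and V_4
    are both of this shape. *)
Lemma skew_s0 (X : 'M[C]_m) : (X - s *m X^T *m s) *m s + s *m (X - s *m X^T *m s)^T = 0.
Proof.
rewrite raddfB /= !trmx_mul trmxK s0_tr mulmxBl mulmxBr -!mulmxA s0_sqr mulmx1.
by rewrite [s *m (s *m _)]mulmxA s0_sqr mul1mx addrC subrKA subrr.
Qed.

Lemma orthogonal_inv (A : 'M[C]_m) : A^T *m s *m A = s -> A *m (s *m A^T *m s) = 1%:M.
Proof. by move=> e; apply: mulmx1C; rewrite -!mulmxA [A^T *m _]mulmxA e s0_sqr. Qed.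

End Orthogonal.

(** * The gauge group and its action on the coefficient matrices by conjugation *)

Section GaugeGroup.
Variables (C : fieldType) (r : nat).
Local Notation m := (mid r).
Local Notation s := (s0 C r).
Local Notation K := (bform C r).
Local Notation J := (Jmx C m).
Implicit Types (h : 'M[C]_(1 + m + 1)) (q p u v : 'cV[C]_m) (A : 'M[C]_m).

Lemma invmxE n (M N : 'M[C]_n) : M *m N = 1%:M -> M \in unitmx /\ invmx M = N.
Proof.
move=> MN; have [uM _] := mulmx1_unit MN.
by split=> //; rewrite -[RHS]mul1mx -(mulVmx uM) -mulmxA MN mulmx1.
Qed.

Lemma orthogonal_bform a A : a != 0 -> A^T *m s *m A = s ->
  let h := diag3 a A a^-1 in
  h *m K *m h^T = K /\ h *m J *m K *m h^T = J *m K.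
Proof.
move=> a0 eA h.
have eA' : A *m s *m A^T = s.
  by rewrite -[RHS]mul1mx -(orthogonal_inv eA) -!mulmxA s0_sqr mulmx1.
have eK : h *m K *m h^T = K by rewrite diag3_form_tr eA' mulfV // mulVf.
split=> //.
have -> : h *m J = J *m h by exact: diag3_J.
by rewrite -[in RHS]eK !mulmxA.
Qed.

(** The first identity makes [K *m h^T *m K] the inverse of [h]; the second then reads h J h^{-1} =
    J, so [h] is block-diagonal. Going back to the first identity block by block gives [a * d = 1]
    and the orthogonality of [A]. *)
Lemma bform_orthogonal h : 2 != 0 :> C ->
  h *m K *m h^T = K -> h *m J *m K *m h^T = J *m K ->
  exists a A, [/\ a != 0, A^T *m s *m A = s & h = diag3 a A a^-1].
Proof.
move=> n2 eK eJ.
have hV : h *m (K *m h^T *m K) = 1%:M by rewrite !mulmxA eK bform_sqr.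
have Vh := mulmx1C hV.
have hJ : h *m J = J *m h.
  have e : (h *m J) *m (K *m h^T *m K) = J by rewrite !mulmxA eJ -mulmxA bform_sqr mulmx1.
  by rewrite -{2}e -mulmxA Vh mulmx1.
have [a [A [d eh]]] := commJ_diag n2 hJ.
move: eK; rewrite eh diag3_form_tr => /mx3_inj[[_ _ ead] [[_ eA _] _]].
have {}ead : a * d = 1 by have := congr1 (fun M : 'M[C]_1 => M 0 0) ead; rewrite !mxE eqxx.
have a0 : a != 0.
  by apply/eqP => a0; move/eqP: ead; rewrite a0 mul0r eq_sym oner_eq0.
have {}eA : A *m s *m A^T = s by apply: oppr_inj.
exists a, A; split=> //; last by congr diag3; apply: (mulfI a0); rewrite ead mulfV.
(* A right inverse of a square matrix is a left inverse, which turns A s A^T = s into A^T s A =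
   s. *)
have : A *m (s *m A^T *m s) = 1%:M by rewrite !mulmxA eA s0_sqr.
move=> /mulmx1C/(congr1 (mulmx s)).
by rewrite !mulmxA s0_sqr mul1mx mulmx1.
Qed.

Lemma orthogonal_invmx a A : a != 0 -> A^T *m s *m A = s ->
  diag3 a A a^-1 \in unitmx /\
  invmx (diag3 a A a^-1) = diag3 a^-1 (s *m A^T *m s) a.
Proof.
move=> a0 eA; apply: invmxE.
by rewrite diag3_mul (orthogonal_inv eA) mulfV // mulVf // diag3_1.
Qed.

Lemma dotM u v : u^T *m v = (dot u v)%:M.
Proof. exact: mx11_scalar. Qed.

Lemma dotC u v : dot u v = dot v u.
Proof. by rewrite /dot -[u^T *m v]trmxK trmx_mul trmxK mxE. Qed.

Variables (a : C) (A : 'M[C]_m).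
Hypotheses (a0 : a != 0) (eA : A^T *m s *m A = s).
Let h := diag3 a A a^-1.
Let h' := diag3 a^-1 (s *m A^T *m s) a.
(** Orthogonality gives A^{-1} = s A^T s, so [s *m A *m s] is the inverse transpose of [A]: the
    vectors q and p transform contragrediently, and [dot q p] is invariant. *)
Let actq q := a *: (s *m A *m s *m q).
Let actp p := a^-1 *: (A *m p).

Let actq_tr q : (actq q)^T = a *: (q^T *m s *m A^T *m s).
Proof. by rewrite /actq linearZ /= !trmx_mul s0_tr !mulmxA. Qed.

Let actp_tr p : (actp p)^T *m s = a^-1 *: (p^T *m s *m s *m A^T *m s).
Proof.
rewrite /actp linearZ /= trmx_mul -scalemxAl; congr (_ *: _).
by rewrite -[p^T *m s *m s]mulmxA s0_sqr mulmx1.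
Qed.

Let s_actq q : s *m actq q = a *: (A *m s *m q).
Proof. by rewrite /actq -scalemxAr !mulmxA s0_sqr mul1mx. Qed.

Lemma diag3_conj_offdiag x12 x21 x23 x32 :
  h *m mx3 0 x12 0 x21 0 x23 0 x32 0 *m h' =
  mx3 0 (a *: (x12 *m s *m A^T *m s)) 0
      (a^-1 *: (A *m x21)) 0 (a *: (A *m x23))
      0 (a^-1 *: (x32 *m s *m A^T *m s)) 0.
Proof.
rewrite /h /h' /diag3 !mx3_mul !(mul0mx, mulmx0, addr0, add0r).
by rewrite !(mul_mx_scalar, mul_scalar_mx) -!scalemxAl !mulmxA.
Qed.

(** The point is that one pair [q'], [p'] serves for Q and V_2 together: the blocks of V_2 are built
    from q and p compatibly with the action, so the gauged V_2 is determined by the gauged Q. *)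
Lemma orthogonal_conj_Q q p : exists q' p',
  [/\ h *m mx3 0 q^T 0 p 0 (s *m q) 0 (p^T *m s) 0 *m h' =
      mx3 0 q'^T 0 p' 0 (s *m q') 0 (p'^T *m s) 0 &
      h *m diag3 (dot q p) (s *m q *m p^T *m s - p *m q^T) (- dot q p) *m h' =
      diag3 (dot q' p') (s *m q' *m p'^T *m s - p' *m q'^T) (- dot q' p')].
Proof.
exists (actq q), (actp p); split.
  by rewrite diag3_conj_offdiag actq_tr s_actq actp_tr !mulmxA.
have e : p^T *m s *m s = p^T by rewrite -mulmxA s0_sqr mulmx1.
have -> : dot (actq q) (actp p) = dot q p.
  rewrite /dot actq_tr /actp -scalemxAl -scalemxAr scalerA mulfV // scale1r.
  have -> : q^T *m s *m A^T *m s *m (A *m p) = q^T *m (s *m (A^T *m s *m A)) *m p.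
    by rewrite !mulmxA.
  by rewrite eA s0_sqr mulmx1.
have eqp : s *m actq q *m (actp p)^T *m s = A *m s *m q *m p^T *m A^T *m s.
  rewrite s_actq -mulmxA actp_tr -scalemxAl -scalemxAr scalerA mulfV // scale1r e.
  by rewrite !mulmxA.
have epq : actp p *m (actq q)^T = A *m p *m q^T *m s *m A^T *m s.
  rewrite actq_tr /actp -scalemxAl -scalemxAr scalerA mulVf // scale1r.
  by rewrite !mulmxA.
rewrite eqp epq /h /h' !diag3_mul mulrAC mulfV // mul1r mulrAC mulVf // mul1r.
congr diag3; rewrite mulmxBr mulmxBl !mulmxA; congr (_ - _).
by rewrite -[_ *m s *m s]mulmxA s0_sqr mulmx1.
Qed.

Lemma orthogonal_conj_V3 q p : exists q' p',
  h *m mx3 0 q^T 0 (- p) 0 (s *m q) 0 (- (p^T *m s)) 0 *m h' =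
  mx3 0 q'^T 0 (- p') 0 (s *m q') 0 (- (p'^T *m s)) 0.
Proof.
exists (actq q), (actp p).
by rewrite diag3_conj_offdiag actq_tr s_actq actp_tr !mulNmx mulmxN !scalerN !mulmxA.
Qed.

End GaugeGroup.

(** * Products of block-diagonal and block-off-diagonal matrices *)

Section OffDiagonal.
Variables (C : fieldType) (m : nat).

Lemma diag3_mul_offdiag a (A : 'M[C]_m) d x12 x21 x23 x32 :
  diag3 a A d *m mx3 0 x12 0 x21 0 x23 0 x32 0 =
  mx3 0 (a *: x12) 0 (A *m x21) 0 (A *m x23) 0 (d *: x32) 0.
Proof.
by rewrite /diag3 mx3_mul !(mul0mx, mulmx0, addr0, add0r) !mul_scalar_mx.
Qed.

Lemma offdiag_mul_diag3 a (A : 'M[C]_m) d x12 x21 x23 x32 :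
  mx3 0 x12 0 x21 0 x23 0 x32 0 *m diag3 a A d =
  mx3 0 (x12 *m A) 0 (a *: x21) 0 (d *: x23) 0 (x32 *m A) 0.
Proof.
by rewrite /diag3 mx3_mul !(mul0mx, mulmx0, addr0, add0r) !mul_mx_scalar.
Qed.

Lemma offdiag_mul (x12 : 'rV[C]_m) x21 x23 x32 y12 y21 y23 y32 :
  mx3 0 x12 0 x21 0 x23 0 x32 0 *m mx3 0 y12 0 y21 0 y23 0 y32 0 =
  mx3 (x12 *m y21) 0 (x12 *m y23) 0 (x21 *m y12 + x23 *m y32) 0
      (x32 *m y21) 0 (x32 *m y23).
Proof. by rewrite mx3_mul !(mul0mx, mulmx0, addr0, add0r). Qed.

Lemma mx3_sub a11 a12 a13 a21 a22 a23 a31 a32 a33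
              b11 b12 b13 b21 b22 b23 b31 b32 b33 :
  @mx3 C m a11 a12 a13 a21 a22 a23 a31 a32 a33 -
  mx3 b11 b12 b13 b21 b22 b23 b31 b32 b33 =
  mx3 (a11 - b11) (a12 - b12) (a13 - b13) (a21 - b21) (a22 - b22) (a23 - b23)
      (a31 - b31) (a32 - b32) (a33 - b33).
Proof. by rewrite mx3_opp mx3_add. Qed.

End OffDiagonal.

Lemma trmxE (C : fieldType) k l (A : 'M[C]_(k, l)) i j : A^T i j = A j i.
Proof. by rewrite mxE. Qed.

(** * The commutators of the Lax coefficients, and skewness of the diagonal ones *)

Section Commutators.
Variables (C : fieldType) (r : nat) (ii : C).
Hypothesis ii2 : ii * ii = -1.
Local Notation m := (mid r).
Local Notation s := (s0 C r).
Local Notation J := (Jmx C m).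
Implicit Types (q p u v : 'cV[C]_m).
Local Notation Qm q p := (mx3 0 q^T 0 p 0 (s *m q) 0 (p^T *m s) 0).
Local Notation V2m q p :=
  (diag3 (dot q p) (s *m q *m p^T *m s - p *m q^T) (- dot q p)).
Local Notation V3m u v :=
  (ii *: mx3 0 u^T 0 (- v) 0 (s *m u) 0 (- (v^T *m s)) 0).

(** Commutation with [J] multiplies the blocks (1,2), (2,3) by 1 and (2,1), (3,2) by -1, which
    undoes the signs put into V_3. *)
Lemma comm_J_V3 u v : J *m V3m u v - V3m u v *m J = ii *: Qm u v.
Proof.
rewrite -scalemxAr -scalemxAl -scalerBr; congr (_ *: _).
rewrite diag3_mul_offdiag offdiag_mul_diag3 mx3_sub.
by rewrite !(mul0mx, mulmx0, subr0, sub0r, scale1r, scaleN1r, opprK).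
Qed.

(** The source of the cubic terms of the NLEE. The factor 2 adds the contributions of the corner of
    V_2 and of [p *m q^T]; the terms contracted with [s] come from the other summand of the middle
    block. *)
Lemma comm_V2_Q q p :
  V2m q p *m Qm q p - Qm q p *m V2m q p =
  Qm ((2 * dot q p) *: q - dot q (s *m q) *: (s *m p))
     (- ((2 * dot q p) *: p - dot p (s *m p) *: (s *m q))).
Proof.
have ss n (X : 'M[C]_(n, m)) : X *m s *m s = X by rewrite -mulmxA s0_sqr mulmx1.
have ssl n (X : 'M[C]_(m, n)) : s *m (s *m X) = X by rewrite mulmxA s0_sqr mul1mx.
have trB a b u v : (a *: u - b *: (s *m v))^T = a *: u^T - b *: (v^T *m s).
  have -> : v^T *m s = (s *m v)^T by rewrite trmx_mul s0_tr.
  by apply/matrixP => i j; rewrite trmxE !(addmxE, oppmxE, scalemxE) !trmxE.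
rewrite diag3_mul_offdiag offdiag_mul_diag3 mx3_sub !subr0.
have eqp : q^T *m p = (dot q p)%:M by exact: dotM.
have epq : p^T *m q = (dot q p)%:M by rewrite dotC; exact: dotM.
have eqq : q^T *m s *m q = (dot q (s *m q))%:M by rewrite -mulmxA dotM.
have epp : p^T *m s *m p = (dot p (s *m p))%:M by rewrite -mulmxA dotM.
congr mx3.
- rewrite mulmxBr !mulmxA eqp eqq !mul_scalar_mx trB -scalemxAl; mxring.
- rewrite mulmxBl -!mulmxA eqp [p^T *m (s *m p)]mulmxA epp !mul_mx_scalar.
  rewrite -!scalemxAr; mxring.
- rewrite mulmxBl mulmxBr -!mulmxA ssl epq [q^T *m (s *m q)]mulmxA eqq.
  rewrite !mul_mx_scalar -!scalemxAr ssl; mxring.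
- rewrite mulmxBr !mulmxA ss epq epp !mul_scalar_mx linearN /= trB.
  rewrite mulNmx mulmxBl -!scalemxAl ss; mxring.
Qed.

Lemma dot_s0 u v : dot u (s *m v) = dot v (s *m u).
Proof. by rewrite dotC /dot trmx_mul s0_tr mulmxA. Qed.

(** For u = q_x and v = p_x the left side is i (U_2)_x, so this is the coefficient of lambda^2 in
    the curvature equation. *)
Lemma comm_Q_V3 q p u v :
  ii *: diag3 (dot u p + dot q v)
    (s *m u *m p^T *m s + s *m q *m v^T *m s - (v *m q^T + p *m u^T))
    (- (dot u p + dot q v)) =
  V3m u v *m Qm q p - Qm q p *m V3m u v.
Proof.
have ss n (X : 'M[C]_(n, m)) : X *m s *m s = X by rewrite -mulmxA s0_sqr mulmx1.
(* Symmetry of [s] is what makes the corners (1,3) and (3,1) of the commutator vanish. *)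
have eqsu : q^T *m (s *m u) = u^T *m (s *m q) by rewrite !dotM dot_s0.
have epsv : p^T *m s *m v = v^T *m s *m p by rewrite -!mulmxA !dotM dot_s0.
rewrite -scalemxAr -scalemxAl -scalerBr; congr (_ *: _).
rewrite !offdiag_mul mx3_sub /diag3 !subr0; congr mx3.
- by rewrite mulmxN opprK !dotM raddfD.
- by rewrite eqsu subrr.
- rewrite mulNmx mulmxN !mulmxA; mxring.
- by rewrite mulNmx mulmxN opprK epsv addNr.
- rewrite mulNmx !mulmxA !ss !dotM raddfN raddfD /= opprD addrC -[dot u p]dotC.
  by rewrite [dot v q]dotC.
Qed.

Lemma skew_V2 q p : let X := s *m q *m p^T *m s - p *m q^T in
  X *m s + s *m X^T = 0.
Proof.
rewrite /=; have -> : s *m q *m p^T *m s - p *m q^T =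
    - (p *m q^T) - s *m (- (p *m q^T))^T *m s.
  by rewrite raddfN /= trmx_mul trmxK mulmxN mulNmx opprK addrC !mulmxA.
exact: skew_s0.
Qed.

Lemma skew_V4 q p u v d :
  let X := ii *: (v *m q^T - p *m u^T + s *m (u *m p^T - q *m v^T) *m s)
    - d *: (p *m q^T - s *m q *m p^T *m s) in
  X *m s + s *m X^T = 0.
Proof.
(* [Y] collects the terms of [X] that are not wrapped in [s]; the others form its adjoint with a
   minus sign. *)
move=> X; pose Y := ii *: (v *m q^T - p *m u^T) - d *: (p *m q^T).
have -> : X = Y - s *m Y^T *m s.
  have -> : Y^T = ii *: (q *m v^T - u *m p^T) - d *: (q *m p^T).
    have tr2 (x y : 'cV[C]_m) : x *m y^T = (y *m x^T)^T by rewrite trmx_mul trmxK.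
    rewrite (tr2 q v) (tr2 u p) (tr2 q p).
    by apply/matrixP => i j; rewrite !(trmxE, addmxE, oppmxE, scalemxE).
  rewrite /X /Y !(mulmxBl, mulmxBr) -!scalemxAr -!scalemxAl !(mulmxBl, mulmxBr) !mulmxA.
  mxring.
exact: skew_s0.
Qed.

End Commutators.

(** Degrees 4 to 6 cancel because both potentials end with the same coefficients U_2, Q, -J. Degree
    3 is the equation for [Qx], degree 2 the one for [U2x] together with [J, V_4] = 0, and degree 0
    the one for [V4x]. *)
Lemma zero_curvature_expansion (C : fieldType) n
    (J Q U2 V3 V4 Qx U2x V3x V4x Qt U2t : 'M[C]_n) (ii lam : C) :
  J *m U2 = U2 *m J -> J *m V4 = V4 *m J ->
  ii *: Qx = J *m V3 - V3 *m J -> ii *: U2x = V3 *m Q - Q *m V3 ->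
  ii *: V4x = ii *: U2t - (U2 *m V4 - V4 *m U2) ->
  let U := U2 + lam *: Q - lam ^+ 2 *: J in
  let V := V4 + lam *: V3 + lam ^+ 2 *: U2 + lam ^+ 3 *: Q - lam ^+ 4 *: J in
  ii *: (V4x + lam *: V3x + lam ^+ 2 *: U2x + lam ^+ 3 *: Qx)
    - ii *: (U2t + lam *: Qt) + (U *m V - V *m U) =
  lam *: (ii *: V3x - ii *: Qt + (U2 *m V3 - V3 *m U2) + (Q *m V4 - V4 *m Q)).
Proof.
move=> JU JV eQ eU eV U V.
have zC (a : C) (M : 'M[C]_n) : ii *: (a *: M) = a *: (ii *: M).
  by rewrite !scalerA mulrC.
rewrite !(scalerDr ii) !zC eQ eU eV /U /V.
rewrite !(mulmxDl, mulmxDr, mulNmx, mulmxN) -!scalemxAl -!scalemxAr JU JV.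
mxring.
Qed.

(** * Derivatives of gauged matrices, conserved forms, and the commutator of the Lax operators *)

Section Operators.
Variable R : realType.
Local Notation C := (R[i]).
Local Notation ii := ('i%C : C).

Lemma ii_sqr : ii * ii = -1.
Proof. by rewrite -expr2 sqr_i. Qed.

Lemma ii_scaleK m n (A : 'M[C]_(m, n)) : ii *: (ii *: A) = - A.
Proof. by rewrite scalerA ii_sqr scaleN1r. Qed.

Lemma ii_scale_inj m n (A B : 'M[C]_(m, n)) : ii *: A = ii *: B -> A = B.
Proof. by move/(congr1 (fun X => ii *: X)); rewrite !ii_scaleK => /oppr_inj. Qed.

Lemma is_mderive_unique m n x (F : R -> 'M[C]_(m, n)) A B :
  is_mderive x F A -> is_mderive x F B -> A = B.
Proof.
move=> dA dB; apply/matrixP => i j.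
by rewrite -(is_cderive_cderive (dA i j)) -(is_cderive_cderive (dB i j)).
Qed.

Lemma is_mderive_eq m n x (F : R -> 'M[C]_(m, n)) A B :
  is_mderive x F A -> A = B -> is_mderive x F B.
Proof. by move=> + <-. Qed.

Lemma is_mderiveMl m n k x (A : 'M[C]_(m, n)) (F : R -> 'M[C]_(n, k)) F' :
  is_mderive x F F' -> is_mderive x (fun y => A *m F y) (A *m F').
Proof.
move=> dF; apply: is_mderive_eq (is_mderiveM (is_mderive_cst x A) dF) _.
by rewrite mul0mx add0r.
Qed.

Lemma is_mderiveMr m n k x (A : 'M[C]_(n, k)) (F : R -> 'M[C]_(m, n)) F' :
  is_mderive x F F' -> is_mderive x (fun y => F y *m A) (F' *m A).
Proof.
move=> dF; apply: is_mderive_eq (is_mderiveM dF (is_mderive_cst x A)) _.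
by rewrite mulmx0 addr0.
Qed.

Lemma is_mderive_mx3 m x a11 a12 a13 a21 a22 a23 a31 a32 a33
    b11 b12 b13 b21 b22 b23 b31 b32 b33 :
  is_mderive x a11 b11 -> is_mderive x a12 b12 -> is_mderive x a13 b13 ->
  is_mderive x a21 b21 -> is_mderive x a22 b22 -> is_mderive x a23 b23 ->
  is_mderive x a31 b31 -> is_mderive x a32 b32 -> is_mderive x a33 b33 ->
  is_mderive x (fun y => mx3 (a11 y) (a12 y) (a13 y) (a21 y) (a22 y) (a23 y)
                             (a31 y) (a32 y) (a33 y) : 'M[C]_(1 + m + 1))
    (mx3 b11 b12 b13 b21 b22 b23 b31 b32 b33).
Proof.
move=> d11 d12 d13 d21 d22 d23 d31 d32 d33.
apply: is_mderive_block => //; first exact: is_mderive_block.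
  exact: is_mderive_col_mx.
exact: is_mderive_row_mx.
Qed.

Lemma gauge_derive n x (g F : R -> 'M[C]_n) (U F' g' G' : 'M[C]_n) :
  (forall y, g y \in unitmx) -> is_mderive x g g' -> ii *: g' = g x *m U ->
  is_mderive x F F' -> is_mderive x (fun y => g y *m F y *m invmx (g y)) G' ->
  ii *: G' = g x *m (ii *: F' + (U *m F x - F x *m U)) *m invmx (g x).
Proof.
move=> ug dg eg dF dG.
have dGg := is_mderiveM dG dg.
have dgF := is_mderiveM dg dF.
(* The identity (g F g^{-1}) g = g F is differentiated, so that no derivative of the inverse is
   needed. *)
have e : G' *m g x + (g x *m F x *m invmx (g x)) *m g' = g' *m F x + g x *m F'.
  apply: is_mderive_unique dGg _.
  by under eq_fun do rewrite mulmxKV //.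
have {}e : ii *: G' *m g x = g x *m (ii *: F' + (U *m F x - F x *m U)).
  move/(congr1 (fun X => ii *: X)): e.
  rewrite !scalerDr (scalemxAl ii g') (scalemxAr ii _ g') eg -scalemxAl => /(canRL (addrK _)) ->.
  rewrite mulmxDr mulmxBr -scalemxAr !mulmxA mulmxKV //.
  by rewrite [X in X - _]addrC addrA.
by rewrite -e mulmxK.
Qed.

(** Up to the factor i, the derivative is g N (U K + K U^T) g^T, once [U] is moved past [N]. It is
    used with N = 1 for orthogonality and N = J for commutation with J. *)
Lemma conserved_form n (N K : 'M[C]_n) (g g' U : R -> 'M[C]_n) :
  (forall x, is_mderive x g (g' x)) -> (forall x, ii *: g' x = g x *m U x) ->
  (forall x, U x *m N = N *m U x) -> (forall x, U x *m K + K *m (U x)^T = 0) ->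
  forall x y, g x *m N *m K *m (g x)^T = g y *m N *m K *m (g y)^T.
Proof.
move=> dg eg eN eK.
apply: (mderive0_cst (F := fun x => g x *m N *m K *m (g x)^T)) => x.
have d1 := is_mderiveMr K (is_mderiveMr N (dg x)).
apply: is_mderive_eq (is_mderiveM d1 (is_mderive_tr (dg x))) _.
have eg' : ii *: (g' x)^T = (U x)^T *m (g x)^T.
  by rewrite -trmx_mul -eg; apply/matrixP => i j; rewrite !(trmxE, scalemxE).
apply: ii_scale_inj; rewrite scaler0 scalerDr (scalemxAr ii _ (g' x)^T) eg'.
rewrite !scalemxAl eg -[g x *m U x *m N]mulmxA eN.
have -> : g x *m (N *m U x) *m K *m (g x)^T = g x *m N *m (U x *m K) *m (g x)^T.
  by rewrite !mulmxA.
have -> : g x *m N *m K *m ((U x)^T *m (g x)^T) = g x *m N *m (K *m (U x)^T) *m (g x)^T.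
  by rewrite !mulmxA.
by rewrite -mulmxDl -mulmxDr eK mulmx0 mul0mx.
Qed.

(** The mixed second derivative [Pxt] and all terms in [Px] and [Pt] occur equally on both sides;
    what is left has order zero in [P]. *)
Lemma commutator_algebra (D : fieldType) n k (U V Vx Ut : 'M[D]_n)
    (P Px Pt Pxt : 'M[D]_(n, k)) (c : D) :
  (c *: (c *: Pxt + (Vx *m P + V *m Px)) + U *m (c *: Pt + V *m P)) -
  (c *: (c *: Pxt + (Ut *m P + U *m Pt)) + V *m (c *: Px + U *m P)) =
  (c *: Vx - c *: Ut + (U *m V - V *m U)) *m P.
Proof.
rewrite !(mulmxDl, mulmxDr, mulNmx) -!scalemxAl -!scalemxAr !mulmxA.
mxring.
Qed.

Lemma oper_commutator n k (U V : R -> R -> 'M[C]_n) (psi : R -> R -> 'M[C]_(n, k)) x t :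
  class_C 1 U -> class_C 1 V -> class_C 2 psi ->
  xoper U (toper V psi) x t - toper V (xoper U psi) x t =
  (ii *: dx V x t - ii *: dt U x t + (U x t *m V x t - V x t *m U x t)) *m psi x t.
Proof.
move=> cU cV cpsi.
have d1 : dx (toper V psi) x t = ii *: dx (dt psi) x t +
    (dx V x t *m psi x t + V x t *m dx psi x t).
  apply: dxE; apply: is_mderiveD.
    by apply: is_mderiveZ; exact: class_C_derx (class_C_dt cpsi).
  by apply: is_mderiveM; [exact: class_C_derx cV|exact: class_C_derx cpsi].
have d2 : dt (xoper U psi) x t = ii *: dt (dx psi) x t +
    (dt U x t *m psi x t + U x t *m dt psi x t).
  apply: dtE; apply: is_mderiveD.
    by apply: is_mderiveZ; exact: class_C_dert (class_C_dx cpsi).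
  by apply: is_mderiveM; [exact: class_C_dert cU|exact: class_C_dert cpsi].
have -> : xoper U (toper V psi) x t =
    ii *: dx (toper V psi) x t + U x t *m (ii *: dt psi x t + V x t *m psi x t) by [].
have -> : toper V (xoper U psi) x t =
    ii *: dt (xoper U psi) x t + V x t *m (ii *: dx psi x t + U x t *m psi x t) by [].
rewrite d1 d2 (dt_dx cpsi).
exact: commutator_algebra.
Qed.

End Operators.

(** * Derivatives and regularity of Q, V_2, V_3, V_4, and the gauge group over the complex
    numbers *)

Section Coefficients.
Variables (R : realType) (r : nat).
Local Notation C := (R[i]).
Local Notation ii := ('i%C : C).
Local Notation m := (mid r).
Local Notation s := (s0 C r).

Lemma is_mderive_Q x (q p : R -> 'cV[C]_m) q' p' :
  is_mderive x q q' -> is_mderive x p p' ->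
  is_mderive x (fun y => Qmx (q y) (p y)) (Qmx q' p').
Proof.
move=> dq dp; have d0 k l := is_mderive_cst x (0 : 'M[C]_(k, l)).
apply: is_mderive_mx3 (d0 _ _) _ (d0 _ _) (dp : _) (d0 _ _) _ (d0 _ _) _ (d0 _ _).
- exact: is_mderive_tr.
- exact: is_mderiveMl.
- exact (is_mderiveMr s (is_mderive_tr dp)).
Qed.

Lemma is_mderive_V3 x (q p : R -> 'cV[C]_m) q' p' :
  is_mderive x q q' -> is_mderive x p p' ->
  is_mderive x (fun y => V3mx (q y) (p y)) (V3mx q' p').
Proof.
move=> dq dp; have d0 k l := is_mderive_cst x (0 : 'M[C]_(k, l)).
apply: is_mderiveZ.
apply: is_mderive_mx3 (d0 _ _) _ (d0 _ _) _ (d0 _ _) _ (d0 _ _) _ (d0 _ _).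
- exact: is_mderive_tr.
- exact: is_mderiveN.
- exact: is_mderiveMl.
- exact (is_mderiveN (is_mderiveMr s (is_mderive_tr dp))).
Qed.

Lemma is_mderive_dot x (u v : R -> 'cV[C]_m) u' v' :
  is_mderive x u u' -> is_mderive x v v' ->
  is_mderive x (fun y => (dot (u y) (v y))%:M : 'M[C]_1)
    (dot u' (v x) + dot (u x) v')%:M.
Proof.
move=> du dv; rewrite raddfD /= -!dotM.
under eq_fun do rewrite -dotM.
exact (is_mderiveM (is_mderive_tr du) dv).
Qed.

Lemma is_mderive_V2 x (q p : R -> 'cV[C]_m) q' p' :
  is_mderive x q q' -> is_mderive x p p' ->
  is_mderive x (fun y => V2mx (q y) (p y))
   (diag3 (dot q' (p x) + dot (q x) p')
    (s *m q' *m (p x)^T *m s + s *m q x *m p'^T *m s - (p' *m (q x)^T + p x *m q'^T))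
    (- (dot q' (p x) + dot (q x) p'))).
Proof.
move=> dq dp; have d0 k l := is_mderive_cst x (0 : 'M[C]_(k, l)).
have dd := is_mderive_dot dq dp.
apply: is_mderive_mx3 (dd : _) (d0 _ _) (d0 _ _) (d0 _ _) _ (d0 _ _) (d0 _ _) (d0 _ _) _.
- apply: is_mderiveB.
    rewrite -mulmxDl; apply: is_mderiveMr.
    exact (is_mderiveM (is_mderiveMl s dq) (is_mderive_tr dp)).
  exact (is_mderiveM dp (is_mderive_tr dq)).
- rewrite raddfN /=; under eq_fun do rewrite raddfN /=.
  exact: is_mderiveN.
Qed.

Lemma class_C_mx3 k (a11 : R -> R -> 'M[C]_1) (a12 : R -> R -> 'rV[C]_m) a13
    (a21 : R -> R -> 'cV[C]_m) a22 a23 a31 a32 a33 :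
  class_C k a11 -> class_C k a12 -> class_C k a13 ->
  class_C k a21 -> class_C k a22 -> class_C k a23 ->
  class_C k a31 -> class_C k a32 -> class_C k a33 ->
  class_C k (fun x t => mx3 (a11 x t) (a12 x t) (a13 x t) (a21 x t) (a22 x t)
                            (a23 x t) (a31 x t) (a32 x t) (a33 x t)).
Proof.
move=> c11 c12 c13 c21 c22 c23 c31 c32 c33.
apply: class_C_block.
- exact (class_C_block c11 c12 c21 c22).
- exact (class_C_col_mx c13 c23).
- exact (class_C_row_mx c31 c32).
- exact: c33.
Qed.

Lemma class_C_Q k (q p : R -> R -> 'cV[C]_m) : class_C k q -> class_C k p ->
  class_C k (fun x t => Qmx (q x t) (p x t)).
Proof.
move=> cq cp; have c0 a b := class_C_cst k (0 : 'M[C]_(a, b)).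
apply: class_C_mx3 (c0 _ _) _ (c0 _ _) (cp : _) (c0 _ _) _ (c0 _ _) _ (c0 _ _).
- exact (class_C_tr cq).
- exact (class_CM (class_C_cst k s) cq).
- exact (class_CM (class_C_tr cp) (class_C_cst k s)).
Qed.

Lemma class_C_V3 k (q p : R -> R -> 'cV[C]_m) : class_C k q -> class_C k p ->
  class_C k (fun x t => V3mx (q x t) (p x t)).
Proof.
move=> cq cp; have c0 a b := class_C_cst k (0 : 'M[C]_(a, b)).
apply: class_CZ.
apply: class_C_mx3 (c0 _ _) _ (c0 _ _) (class_CN cp) (c0 _ _) _ (c0 _ _) _ (c0 _ _).
- exact (class_C_tr cq).
- exact (class_CM (class_C_cst k s) cq).
- exact (class_CN (class_CM (class_C_tr cp) (class_C_cst k s))).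
Qed.

Lemma class_C_eq k n l (F G : R -> R -> 'M[C]_(n, l)) :
  class_C k F -> (forall x t, F x t = G x t) -> class_C k G.
Proof.
by move=> cF e; rewrite -(_ : F = G) //; apply/funext => x; apply/funext => t.
Qed.

Lemma class_C_dot k (u v : R -> R -> 'cV[C]_m) : class_C k u -> class_C k v ->
  class_C k (fun x t => (dot (u x t) (v x t))%:M : 'M[C]_1).
Proof.
move=> cu cv; apply: class_C_eq (class_CM (class_C_tr cu) cv) _ => x t.
exact: dotM.
Qed.

Lemma class_C_scale_col k (f : R -> R -> C) (u : R -> R -> 'cV[C]_m) :
  class_C k (fun x t => (f x t)%:M : 'M[C]_1) -> class_C k u ->
  class_C k (fun x t => f x t *: u x t).
Proof.
move=> cf cu; apply: class_C_eq (class_CM cu cf) _ => x t.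
exact: mul_mx_scalar.
Qed.

Lemma class_C_V2 k (q p : R -> R -> 'cV[C]_m) : class_C k q -> class_C k p ->
  class_C k (fun x t => V2mx (q x t) (p x t)).
Proof.
move=> cq cp; have c0 a b := class_C_cst k (0 : 'M[C]_(a, b)).
have cs := class_C_cst k s; have cd := class_C_dot cq cp.
apply: class_C_mx3 (cd : _) (c0 _ _) (c0 _ _) (c0 _ _) _ (c0 _ _) (c0 _ _) (c0 _ _) _.
- apply: class_CB.
    exact (class_CM (class_CM (class_CM cs cq) (class_C_tr cp)) cs).
  exact (class_CM cp (class_C_tr cq)).
- by apply: class_C_eq (class_CN cd) _ => x t; rewrite raddfN.
Qed.

Lemma class_C_V4 k (q p u v : R -> R -> 'cV[C]_m) :
  class_C k q -> class_C k p -> class_C k u -> class_C k v ->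
  class_C k (fun x t => V4mx (q x t) (p x t) (u x t) (v x t)).
Proof.
move=> cq cp cu cv; have c0 a b := class_C_cst k (0 : 'M[C]_(a, b)).
have cs := class_C_cst k s; have cd := class_C_dot cq cp.
have [cqT cpT] := (class_C_tr cq, class_C_tr cp).
have [cuT cvT] := (class_C_tr cu, class_C_tr cv).
have c11 : class_C k (fun x t => (V4_11 (q x t) (p x t) (u x t) (v x t))%:M : 'M[C]_1).
  have c1 := class_CZ ii (class_CB (class_C_dot cu cp) (class_C_dot cq cv)).
  have c3 := class_CZ (2^-1) (class_CM (class_C_dot cq (class_CM cs cq))
                                       (class_C_dot cp (class_CM cs cp))).
  apply: class_C_eq (class_CB (class_CD c1 (class_CM cd cd)) c3) _ => x t.
  rewrite -!scalar_mxM -!raddfB /= !scale_scalar_mx -raddfD -raddfB /=.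
  by rewrite -expr2.
apply: class_C_mx3 (c11 : _) (c0 _ _) (c0 _ _) (c0 _ _) _ (c0 _ _) (c0 _ _) (c0 _ _) _.
- apply: class_CB.
    apply: class_CZ; apply: class_CD.
      exact (class_CB (class_CM cv cqT) (class_CM cp cuT)).
    apply: class_CM _ (cs : _); apply: class_CM (cs : _) _.
    exact (class_CB (class_CM cu cpT) (class_CM cq cvT)).
  have c1 := class_CM (class_C_scale_col cd cp) cqT.
  have c2 := class_CM (class_CM (class_CM cs (class_C_scale_col cd cq)) cpT) cs.
  apply: class_C_eq (class_CB c1 c2) _ => x t.
  by rewrite scalerBr -scalemxAr -!scalemxAl.
- by apply: class_C_eq (class_CN c11) _ => x t; rewrite raddfN.
Qed.

(** Trades the existential description for two matrix equations, the form in which membership can be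
    transported by [conserved_form]. *)
Lemma gauge_groupP (h : 'M[C]_(1 + m + 1)) :
  gauge_group h <-> h *m bform C r *m h^T = bform C r /\
                    h *m Jmx C m *m bform C r *m h^T = Jmx C m *m bform C r.
Proof.
split; first by move=> [a [A [a0 eA ->]]]; exact: orthogonal_bform.
by move=> [e1 e2]; apply: bform_orthogonal e1 e2; rewrite pnatr_eq0.
Qed.

Lemma gauge_group_unit (h : 'M[C]_(1 + m + 1)) : gauge_group h -> h \in unitmx.
Proof. by move=> [a [A [a0 eA ->]]]; case: (orthogonal_invmx a0 eA). Qed.

Lemma gauge_group_inv (h : 'M[C]_(1 + m + 1)) : gauge_group h ->
  invmx h = bform C r *m h^T *m bform C r.
Proof.
move=> /gauge_groupP[eK _].
by case: (@invmxE _ _ h (bform C r *m h^T *m bform C r)) => //; rewrite !mulmxA eK bform_sqr.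
Qed.

Lemma gauge_group_J (h : 'M[C]_(1 + m + 1)) : gauge_group h ->
  h *m Jmx C m = Jmx C m *m h.
Proof. by move=> [a [A [a0 eA ->]]]; exact: diag3_J. Qed.

Lemma gauge_group_conj (h : 'M[C]_(1 + m + 1)) (q p : 'cV[C]_m) : gauge_group h ->
  exists q' p', h *m Qmx q p *m invmx h = Qmx q' p' /\
                h *m V2mx q p *m invmx h = V2mx q' p'.
Proof.
move=> [a [A [a0 eA ->]]]; have [_ ->] := orthogonal_invmx a0 eA.
have [q' [p' [eQ eV]]] := orthogonal_conj_Q a0 eA q p.
by exists q', p'; split; [exact: eQ|exact: eV].
Qed.

Lemma gauge_group_conj_V3 (h : 'M[C]_(1 + m + 1)) (q p : 'cV[C]_m) : gauge_group h ->
  exists q' p', h *m V3mx q p *m invmx h = V3mx q' p'.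
Proof.
move=> [a [A [a0 eA ->]]]; have [_ ->] := orthogonal_invmx a0 eA.
have [q' [p' e]] := orthogonal_conj_V3 a A q p.
exists q', p'; rewrite /V3mx -scalemxAr -scalemxAl; congr (_ *: _); exact: e.
Qed.

Lemma Qmx_inj (q p q' p' : 'cV[C]_m) : Qmx q p = Qmx q' p' -> q = q' /\ p = p'.
Proof. by move=> /mx3_inj[[_ /trmx_inj-> _] [[-> _ _] _]]. Qed.

Lemma Qmx_scale c (u v : 'cV[C]_m) : c *: Qmx u v = Qmx (c *: u) (c *: v).
Proof.
rewrite /Qmx mx3_scale !scaler0 [(c *: u)^T]linearZ.
by rewrite [(c *: v)^T]linearZ /= -scalemxAr -scalemxAl.
Qed.

Lemma Qmx_add (u v u' v' : 'cV[C]_m) : Qmx u v + Qmx u' v' = Qmx (u + u') (v + v').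
Proof.
rewrite /Qmx mx3_add !addr0 [(u + u')^T]linearD [(v + v')^T]linearD /=.
by rewrite mulmxDr mulmxDl.
Qed.

Lemma V3mx_Q (u v : 'cV[C]_m) : V3mx u v = Qmx (ii *: u) (- ii *: v).
Proof.
rewrite /V3mx mx3_scale !scaler0 /Qmx [(ii *: u)^T]linearZ [(- ii *: v)^T]linearZ /=.
by rewrite -scalemxAr -scalemxAl !scalerN !scaleNr.
Qed.

Lemma comm_J_V3mx (u v : 'cV[C]_m) :
  Jmx C m *m V3mx u v - V3mx u v *m Jmx C m = ii *: Qmx u v.
Proof. exact (comm_J_V3 _ _ _). Qed.

Lemma comm_V2mx_Qmx (u v : 'cV[C]_m) :
  V2mx u v *m Qmx u v - Qmx u v *m V2mx u v =
  Qmx ((2 * dot u v) *: u - dot u (s *m u) *: (s *m v))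
      (- ((2 * dot u v) *: v - dot v (s *m v) *: (s *m u))).
Proof. exact (comm_V2_Q _ _). Qed.

Lemma Qmx_linear_inj (u v a b c d : 'cV[C]_m) :
  ii *: Qmx u v = ii *: Qmx a b + Qmx c (- d) -> u = a - ii *: c /\ v = b + ii *: d.
Proof.
rewrite [X in X + _]Qmx_scale Qmx_add => e.
have [e1 e2] := Qmx_inj (etrans (esym (Qmx_scale _ _ _)) e).
split; apply: ii_scale_inj; rewrite ?e1 ?e2 ?scalerBr ?scalerDr ii_scaleK //.
by rewrite opprK.
Qed.

Lemma V3mx_eq_Qmx (u v a b : 'cV[C]_m) :
  V3mx a b = Qmx u v <-> ii *: u + a = 0 /\ ii *: v - b = 0.
Proof.
have negK (w : 'cV[C]_m) : - ii *: (ii *: w) = w by rewrite scaleNr ii_scaleK opprK.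
rewrite V3mx_Q; split=> [/Qmx_inj[<- <-]|[eu ev]].
  by rewrite ii_scaleK addNr scaleNr scalerN ii_scaleK opprK subrr.
have -> : a = - (ii *: u) by apply/eqP; rewrite -addr_eq0 addrC eu.
have -> : b = ii *: v by apply/esym/eqP; rewrite -subr_eq0 ev.
by rewrite scalerN ii_scaleK opprK negK.
Qed.

End Coefficients.

(** The last hypothesis equates the two mixed derivatives of [G], each computed from one of the
    linear equations. Multiplying by [c] and substituting those equations again leaves [G] as a
    common left factor. *)
Lemma cross_derivative_algebra (D : fieldType) n (G Gx Gt U V Ut Vx : 'M[D]_n) (c : D) :
  G \in unitmx -> c *: Gx = G *m U -> c *: Gt = G *m V ->
  Gt *m U + G *m Ut = Gx *m V + G *m Vx ->
  c *: Vx = c *: Ut - (U *m V - V *m U).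
Proof.
move=> uG ex et /(congr1 (fun X => c *: X)); rewrite !scalerDr !scalemxAl ex et.
rewrite -!scalemxAl !scalemxAr -!mulmxA -!mulmxDr.
move=> /(congr1 (mulmx (invmx G))); rewrite !mulKmx // => /(canRL (addKr _)) ->.
mxring.
Qed.

Lemma conj_eq (D : fieldType) n (G A B X Y : 'M[D]_n) (c : D) :
  G \in unitmx -> c != 0 -> c *: X = G *m A *m invmx G -> c *: Y = G *m B *m invmx G ->
  A = B <-> X = Y.
Proof.
move=> uG c0 eX eY; split=> [AB|XY]; first by apply: (scalerI c0); rewrite eX eY AB.
have := eX; rewrite XY eY => /(can_inj (mulmxKV uG)) /(can_inj (mulKmx uG)).
by [].
Qed.

(** Groups the coefficient of lambda into two covariant derivatives, of V_3 in x and of Q in t, each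
    of which the gauge turns into an ordinary derivative. *)
Lemma commutator_split (D : fieldType) n (A B U V X Y : 'M[D]_n) (c : D) :
  c *: A - c *: B + (U *m X - X *m U) + (Y *m V - V *m Y) =
  (c *: A + (U *m X - X *m U)) - (c *: B + (V *m Y - Y *m V)).
Proof. mxring. Qed.

Lemma mulmx_eq0 (D : fieldType) n (A : 'M[D]_n) :
  (forall v : 'cV[D]_n, A *m v = 0) -> A = 0.
Proof.
move=> z; apply/matrixP => i j.
by have := congr1 (fun M : 'cV[D]_n => M i 0) (z (delta_mx j 0)); rewrite -colE !mxE.
Qed.

Lemma conj_commutators (D : fieldType) n (G J Q U V X : 'M[D]_n) :
  G \in unitmx -> G *m J = J *m G ->
  X = G *m ((J *m V - V *m J) + (U *m Q - Q *m U)) *m invmx G ->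
  let cj (F : 'M[D]_n) := G *m F *m invmx G in
  X = (J *m cj V - cj V *m J) + (cj U *m cj Q - cj Q *m cj U).
Proof.
move=> uG GJ -> cj.
have cjM A B : cj A *m cj B = G *m (A *m B) *m invmx G by rewrite /cj !mulmxA mulmxKV.
have cjJ : J = cj J by rewrite /cj GJ mulmxK.
have -> : J *m cj V = cj (J *m V) by rewrite {1}cjJ cjM.
have -> : cj V *m J = cj (V *m J) by rewrite {1}cjJ cjM.
rewrite !cjM /cj -!mulmxBl -!mulmxBr -mulmxDl -mulmxDr.
by [].
Qed.

(** The term in [Gx] supplies exactly the potential [U] that the gauged operator lacks;
    [gauge_t_algebra] does the same with [V4]. *)
Lemma gauge_x_algebra (D : fieldType) n k (G Gx U Q J : 'M[D]_n) (P Px : 'M[D]_(n, k))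
    (c l : D) :
  G \in unitmx -> c *: Gx = G *m U -> G *m J = J *m G ->
  c *: (Gx *m P + G *m Px) +
    (l *: (G *m Q *m invmx G) - l ^+ 2 *: J) *m (G *m P) =
  G *m (c *: Px + (U + l *: Q - l ^+ 2 *: J) *m P).
Proof.
move=> uG eG GJ; rewrite scalerDr (scalemxAl c Gx) eG.
rewrite !(mulmxDl, mulmxDr, mulNmx, mulmxN) -!scalemxAl -!scalemxAr !mulmxA.
rewrite mulmxKV // GJ; mxring.
Qed.

Lemma gauge_t_algebra (D : fieldType) n k (G Gt V4 V3 V2 Q J : 'M[D]_n)
    (P Pt : 'M[D]_(n, k)) (c l : D) :
  G \in unitmx -> c *: Gt = G *m V4 -> G *m J = J *m G ->
  c *: (Gt *m P + G *m Pt) +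
    (l *: (G *m V3 *m invmx G) + l ^+ 2 *: (G *m V2 *m invmx G)
     + l ^+ 3 *: (G *m Q *m invmx G) - l ^+ 4 *: J) *m (G *m P) =
  G *m (c *: Pt + (V4 + l *: V3 + l ^+ 2 *: V2 + l ^+ 3 *: Q - l ^+ 4 *: J) *m P).
Proof.
move=> uG eG GJ; rewrite scalerDr (scalemxAl c Gt) eG.
rewrite !(mulmxDl, mulmxDr, mulNmx, mulmxN) -!scalemxAl -!scalemxAr !mulmxA.
rewrite !mulmxKV // GJ; mxring.
Qed.

Lemma mulmx_unit_eq0 (D : fieldType) n k (G : 'M[D]_n) (M : 'M[D]_(n, k)) :
  G \in unitmx -> M = 0 <-> G *m M = 0.
Proof.
move=> uG; split=> [->|e]; first exact: mulmx0.
by rewrite -(mulKmx uG M) e mulmx0.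
Qed.

(** * The gauged Lax pair and the NLEE in the new variables *)

Section GaugedLaxPair.
Variables (R : realType) (r : nat).
Local Notation C := (R[i]).
Local Notation ii := ('i%C : C).
Local Notation m := (mid r).
Local Notation s := (s0 C r).
Variables (q p : R -> R -> 'cV[C]_m).
Hypotheses (hq : class_C 2 q) (hp : class_C 2 p).
Variable g0 : R -> R -> 'M[C]_(1 + m + 1).
Hypotheses (hg0 : class_C 1 g0) (hbase : exists x0 t0, gauge_group (g0 x0 t0)).
Hypotheses (hgx : forall x t, ii *: dx g0 x t = g0 x t *m U2f q p x t)
           (hgt : forall x t, ii *: dt g0 x t = g0 x t *m V4f q p x t).

Local Notation J := (Jmx C m).
Local Notation Qq := (Qf q p).
Local Notation U2 := (U2f q p).
Local Notation V3 := (V3f q p).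
Local Notation V4 := (V4f q p).

Lemma class_C_Qf : class_C 2 Qq. Proof. exact (class_C_Q hq hp). Qed.
Lemma class_C_U2f : class_C 2 U2. Proof. exact (class_C_V2 hq hp). Qed.
Lemma class_C_V3f : class_C 1 V3.
Proof. exact (class_C_V3 (class_C_dx hq) (class_C_dx hp)). Qed.
Lemma class_C_V4f : class_C 1 V4.
Proof.
exact (class_C_V4 (class_C_pred hq) (class_C_pred hp) (class_C_dx hq) (class_C_dx hp)).
Qed.

(** The gauge equations leave a constant left factor of [g0] free, so membership has to be fixed at
    one point. It then spreads along the t-line through [x] and the x-line at [t0]. *)
Lemma gauge_group_everywhere x t : gauge_group (g0 x t).
Proof.
have [x0 [t0 /gauge_groupP[eK eJ]]] := hbase.
have skU y u : U2 y u *m bform C r + bform C r *m (U2 y u)^T = 0.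
  exact (skew_form _ (skew_V2 _ _)).
have skV y u : V4 y u *m bform C r + bform C r *m (V4 y u)^T = 0.
  exact (skew_form _ (skew_V4 _ _ _ _ _ _)).
have UJ y u : U2 y u *m J = J *m U2 y u by exact (diag3_J _ _ _).
have VJ y u : V4 y u *m J = J *m V4 y u by exact (diag3_J _ _ _).
have transport N : (forall y u, U2 y u *m N = N *m U2 y u) ->
    (forall y u, V4 y u *m N = N *m V4 y u) ->
    g0 x t *m N *m bform C r *m (g0 x t)^T = g0 x0 t0 *m N *m bform C r *m (g0 x0 t0)^T.
  move=> UN VN.
  have e1 := conserved_form (fun u => class_C_dert x u hg0) (hgt x) (VN x) (skV x) t t0.
  have e2 := conserved_form (fun y => class_C_derx y t0 hg0) (hgx ^~ t0) (UN ^~ t0) (skU ^~ t0) x x0.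
  exact (etrans e1 e2).
have c1 (M : 'M[C]_(1 + m + 1)) : M *m 1%:M = 1%:M *m M by rewrite mulmx1 mul1mx.
have e1 := transport 1%:M (fun y u => c1 _) (fun y u => c1 _).
rewrite !mulmx1 in e1.
apply/gauge_groupP; exact (conj (etrans e1 eK) (etrans (transport J UJ VJ) eJ)).
Qed.

Let gG := gauge_group_everywhere.
Let ug x t : g0 x t \in unitmx := gauge_group_unit (gG x t).

Lemma class_C_gauge (F : R -> R -> 'M[C]_(1 + m + 1)) :
  class_C 1 F -> class_C 1 (gauge g0 F).
Proof.
move=> cF; have cK := class_C_cst 1 (bform C r).
(* The inverse is replaced by [K *m g0^T *m K], which has the regularity of [g0] itself. *)
apply: class_C_eq (class_CM (class_CM hg0 cF) (class_CM (class_CM cK (class_C_tr hg0)) cK)) _.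
by move=> x t; rewrite /gauge (gauge_group_inv (gG x t)).
Qed.

Lemma dx_gauge (F : R -> R -> 'M[C]_(1 + m + 1)) x t : class_C 1 F ->
  ii *: dx (gauge g0 F) x t =
  g0 x t *m (ii *: dx F x t + (U2 x t *m F x t - F x t *m U2 x t)) *m invmx (g0 x t).
Proof.
move=> cF.
exact (gauge_derive (ug ^~ t) (class_C_derx x t hg0) (hgx x t) (class_C_derx x t cF)
  (class_C_derx x t (class_C_gauge cF))).
Qed.

Lemma dt_gauge (F : R -> R -> 'M[C]_(1 + m + 1)) x t : class_C 1 F ->
  ii *: dt (gauge g0 F) x t =
  g0 x t *m (ii *: dt F x t + (V4 x t *m F x t - F x t *m V4 x t)) *m invmx (g0 x t).
Proof.
move=> cF.
exact (gauge_derive (ug x) (class_C_dert x t hg0) (hgt x t) (class_C_dert x t cF)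
  (class_C_dert x t (class_C_gauge cF))).
Qed.

(* The compatibility of the two linear equations for g_0 is the
   [lambda^0]-coefficient of the zero curvature equation. *)
Lemma gauge_zero_curvature x t :
  ii *: dx V4 x t = ii *: dt U2 x t - (U2 x t *m V4 x t - V4 x t *m U2 x t).
Proof.
have ex y u : dx g0 y u = - ii *: (g0 y u *m U2 y u).
  by rewrite -hgx scaleNr ii_scaleK opprK.
have et y u : dt g0 y u = - ii *: (g0 y u *m V4 y u).
  by rewrite -hgt scaleNr ii_scaleK opprK.
have cU := class_C_pred class_C_U2f; have cV := class_C_V4f.
(* Bootstrap: the right sides of the gauge equations are C^1, hence so are the first derivatives of
   [g0], and equality of its mixed partials becomes available. *)
have cx : class_C 1 (dx g0).
  by apply: class_C_eq (class_CZ (- ii) (class_CM hg0 cU)) _ => y u; rewrite ex.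
have ct : class_C 1 (dt g0).
  by apply: class_C_eq (class_CZ (- ii) (class_CM hg0 cV)) _ => y u; rewrite et.
have c2 : class_C 2 g0.
  split; [exact: class_C_continuous hg0| |exact: cx|exact: ct].
  by case: hg0.
have e1 : ii *: dt (dx g0) x t = dt g0 x t *m U2 x t + g0 x t *m dt U2 x t.
  apply: is_mderive_unique (is_mderiveZ ii (class_C_dert x t cx)) _.
  under eq_fun do rewrite hgx.
  exact (is_mderiveM (class_C_dert x t hg0) (class_C_dert x t cU)).
have e2 : ii *: dx (dt g0) x t = dx g0 x t *m V4 x t + g0 x t *m dx V4 x t.
  apply: is_mderive_unique (is_mderiveZ ii (class_C_derx x t ct)) _.
  under eq_fun do rewrite hgt.
  exact (is_mderiveM (class_C_derx x t hg0) (class_C_derx x t cV)).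
apply: cross_derivative_algebra (ug x t) (hgx x t) (hgt x t) _.
by rewrite -e1 -e2 (dt_dx c2).
Qed.

Definition lax1 x t :=
  ii *: dx V3 x t - ii *: dt Qq x t + (U2 x t *m V3 x t - V3 x t *m U2 x t)
  + (Qq x t *m V4 x t - V4 x t *m Qq x t).

Lemma zero_curvature lam x t :
  ii *: dx (Mpot q p lam) x t - ii *: dt (Lpot q p lam) x t +
  (Lpot q p lam x t *m Mpot q p lam x t - Mpot q p lam x t *m Lpot q p lam x t) =
  lam *: lax1 x t.
Proof.
have dVx : dx (Mpot q p lam) x t = dx V4 x t + lam *: dx V3 x t
    + lam ^+ 2 *: dx U2 x t + lam ^+ 3 *: dx Qq x t.
  apply: dxE; rewrite -[X in is_mderive _ _ X]subr0.
  have d4 := class_C_derx x t class_C_V4f.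
  have d3 := is_mderiveZ lam (class_C_derx x t class_C_V3f).
  have d2 := is_mderiveZ (lam ^+ 2) (class_C_derx x t class_C_U2f).
  have d1 := is_mderiveZ (lam ^+ 3) (class_C_derx x t class_C_Qf).
  have d0 := is_mderive_cst x (lam ^+ 4 *: J).
  exact (is_mderiveB (is_mderiveD (is_mderiveD (is_mderiveD d4 d3) d2) d1) d0).
have dUt : dt (Lpot q p lam) x t = dt U2 x t + lam *: dt Qq x t.
  apply: dtE; rewrite -[X in is_mderive _ _ X]subr0.
  have d2 := class_C_dert x t class_C_U2f.
  have d1 := is_mderiveZ lam (class_C_dert x t class_C_Qf).
  have d0 := is_mderive_cst t (lam ^+ 2 *: J).
  exact (is_mderiveB (is_mderiveD d2 d1) d0).
rewrite dVx dUt.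
have dqx := class_C_derx x t hq; have dpx := class_C_derx x t hp.
apply: zero_curvature_expansion.
- exact (esym (diag3_J _ _ _)).
- exact (esym (diag3_J _ _ _)).
- rewrite (dxE (is_mderive_Q dqx dpx)); exact (esym (comm_J_V3 _ _ _)).
- rewrite (dxE (is_mderive_V2 dqx dpx)); exact (comm_Q_V3 _ _ _ _ _).
- exact: gauge_zero_curvature.
Qed.

Lemma class_C_Lpot lam : class_C 1 (Lpot q p lam).
Proof.
exact (class_CB (class_CD (class_C_pred class_C_U2f) (class_CZ lam (class_C_pred class_C_Qf)))
  (class_C_cst 1 (lam ^+ 2 *: J))).
Qed.

Lemma class_C_Mpot lam : class_C 1 (Mpot q p lam).
Proof.
exact (class_CB (class_CD (class_CD (class_CD class_C_V4f (class_CZ lam class_C_V3f))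
  (class_CZ (lam ^+ 2) (class_C_pred class_C_U2f)))
  (class_CZ (lam ^+ 3) (class_C_pred class_C_Qf)))
  (class_C_cst 1 (lam ^+ 4 *: J))).
Qed.

Lemma compatible_lax1 : compatible q p <-> forall x t, lax1 x t = 0.
Proof.
split=> [cmp x t|e lam psi cpsi x t]; last first.
  apply/eqP; rewrite -subr_eq0; apply/eqP.
  rewrite (oper_commutator x t (class_C_Lpot lam) (class_C_Mpot lam) cpsi).
  by rewrite zero_curvature e scaler0 mul0mx.
(* At lambda = 1 a constant test function suffices, since the commutator acts as multiplication by
   [lax1]. *)
have z (v : 'cV[C]_(1 + m + 1)) : lax1 x t *m v = 0.
  have cv := class_C_cst 2 v.
  have := oper_commutator x t (class_C_Lpot 1) (class_C_Mpot 1) cv.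
  by rewrite (cmp 1 _ cv x t) subrr zero_curvature scale1r.
exact: mulmx_eq0 z.
Qed.

Lemma lax1_gauge x t :
  lax1 x t = 0 <-> dx (gauge g0 V3) x t = dt (gauge g0 Qq) x t.
Proof.
have ii0 : ii != 0.
  by apply/eqP => z; have /eqP := ii_sqr R; rewrite z mul0r eq_sym oppr_eq0 oner_eq0.
apply: iff_trans (conj_eq (ug x t) ii0 (dx_gauge x t class_C_V3f)
  (dt_gauge x t (class_C_pred class_C_Qf))).
by rewrite /lax1 commutator_split; split=> [/eqP|->]; [rewrite subr_eq0 => /eqP|exact: subrr].
Qed.

Local Notation qt := (gq g0 q p).
Local Notation pt := (gp g0 q p).

Lemma gauge_QV2 x t :
  gauge g0 Qq x t = Qmx (qt x t) (pt x t) /\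
  gauge g0 (V2f q p) x t = V2mx (qt x t) (pt x t).
Proof.
have [q' [p' [eQ eV]]] := gauge_group_conj (q x t) (p x t) (gG x t).
have eQ' : gauge g0 Qq x t = Qmx q' p' by exact eQ.
have -> : qt x t = q' by rewrite /gq eQ' mx3_12E trmxK.
have -> : pt x t = p' by rewrite /gp eQ' mx3_21E.
exact (conj eQ' eV).
Qed.

(* The blocks of the gauged V_3, normalised so that they stand where
   [q_x] and [p_x] stand in V_3. *)
Definition gV3q x t : 'cV[C]_m := - ii *: (mx3_12 (gauge g0 V3 x t))^T.
Definition gV3p x t : 'cV[C]_m := ii *: mx3_21 (gauge g0 V3 x t).

Lemma gauge_V3 x t : gauge g0 V3 x t = V3mx (gV3q x t) (gV3p x t).
Proof.
have [q' [p' e]] := gauge_group_conj_V3 (dx q x t) (dx p x t) (gG x t).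
have e' : gauge g0 V3 x t = V3mx q' p' by exact e.
have -> : gV3q x t = q'.
  rewrite /gV3q e' /V3mx mx3_scale mx3_12E linearZ /= trmxK.
  by rewrite scaleNr ii_scaleK opprK.
have -> : gV3p x t = p'.
  by rewrite /gV3p e' /V3mx mx3_scale mx3_21E ii_scaleK opprK.
exact e'.
Qed.

Lemma class_C_mx3_12 k (F : R -> R -> 'M[C]_(1 + m + 1)) :
  class_C k F -> class_C k (fun x t => mx3_12 (F x t)).
Proof.
by move=> cF; exact (class_C_rsubmx (class_C_usubmx (class_C_lsubmx (class_C_usubmx cF)))).
Qed.

Lemma class_C_mx3_21 k (F : R -> R -> 'M[C]_(1 + m + 1)) :
  class_C k F -> class_C k (fun x t => mx3_21 (F x t)).
Proof.
by move=> cF; exact (class_C_lsubmx (class_C_dsubmx (class_C_lsubmx (class_C_usubmx cF)))).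
Qed.

Lemma class_C_gq : class_C 1 qt.
Proof. exact (class_C_tr (class_C_mx3_12 (class_C_gauge (class_C_pred class_C_Qf)))). Qed.

Lemma class_C_gp : class_C 1 pt.
Proof. exact (class_C_mx3_21 (class_C_gauge (class_C_pred class_C_Qf))). Qed.

Lemma class_C_gV3q : class_C 1 gV3q.
Proof. exact (class_CZ _ (class_C_tr (class_C_mx3_12 (class_C_gauge class_C_V3f)))). Qed.

Lemma class_C_gV3p : class_C 1 gV3p.
Proof. exact (class_CZ _ (class_C_mx3_21 (class_C_gauge class_C_V3f))). Qed.

Definition cubic_q x t : 'cV[C]_m :=
  (2 * dot (qt x t) (pt x t)) *: qt x t
  - dot (qt x t) (s *m qt x t) *: (s *m pt x t).

Definition cubic_p x t : 'cV[C]_m :=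
  (2 * dot (qt x t) (pt x t)) *: pt x t
  - dot (pt x t) (s *m pt x t) *: (s *m qt x t).

Lemma class_C_cubic (u v w : R -> R -> 'cV[C]_m) :
  class_C 1 u -> class_C 1 v -> class_C 1 w ->
  class_C 1 (fun x t => (2 * dot (u x t) (v x t)) *: w x t).
Proof.
move=> cu cv cw; apply: class_C_scale_col cw.
apply: class_C_eq (class_CZ 2 (class_C_dot cu cv)) _ => x t.
exact: scale_scalar_mx.
Qed.

Lemma class_C_cubic_q : class_C 1 cubic_q.
Proof.
have [cq cp] := (class_C_gq, class_C_gp); have cs := class_C_cst 1 s.
exact (class_CB (class_C_cubic cq cp cq)
  (class_C_scale_col (class_C_dot cq (class_CM cs cq)) (class_CM cs cp))).
Qed.

Lemma class_C_cubic_p : class_C 1 cubic_p.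
Proof.
have [cq cp] := (class_C_gq, class_C_gp); have cs := class_C_cst 1 s.
exact (class_CB (class_C_cubic cq cp cp)
  (class_C_scale_col (class_C_dot cp (class_CM cs cp)) (class_CM cs cq))).
Qed.

(* The gauge image of the [lambda^3]-coefficient [i Q_x = [J, V_3]]. *)
Lemma gq_gp_dx x t :
  dx qt x t = gV3q x t - ii *: cubic_q x t /\
  dx pt x t = gV3p x t + ii *: cubic_p x t.
Proof.
have [dq dp] := (class_C_derx x t class_C_gq, class_C_derx x t class_C_gp).
have dQ : dx (gauge g0 Qq) x t = Qmx (dx qt x t) (dx pt x t).
  apply: is_mderive_unique (class_C_derx x t (class_C_gauge (class_C_pred class_C_Qf))) _.
  have -> : (gauge g0 Qq)^~ t = fun y => Qmx (qt y t) (pt y t).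
    by apply/funext => y; case: (gauge_QV2 y t).
  exact (is_mderive_Q dq dp).
have JQ : ii *: dx Qq x t = J *m V3 x t - V3 x t *m J.
  rewrite (dxE (is_mderive_Q (class_C_derx x t hq) (class_C_derx x t hp))).
  exact (esym (comm_J_V3 _ _ _)).
have e := dx_gauge x t (class_C_pred class_C_Qf).
rewrite dQ JQ in e.
have e2 := conj_commutators (ug x t) (gauge_group_J (gG x t)) e.
have [eQ eV] := gauge_QV2 x t.
have e3 : ii *: Qmx (dx qt x t) (dx pt x t) =
    (J *m V3mx (gV3q x t) (gV3p x t) - V3mx (gV3q x t) (gV3p x t) *m J) +
    (V2mx (qt x t) (pt x t) *m Qmx (qt x t) (pt x t)
     - Qmx (qt x t) (pt x t) *m V2mx (qt x t) (pt x t)).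
  by rewrite -eQ -eV -gauge_V3; exact e2.
have e4 : ii *: Qmx (dx qt x t) (dx pt x t) =
    ii *: Qmx (gV3q x t) (gV3p x t) + Qmx (cubic_q x t) (- cubic_p x t).
  exact (etrans e3 (f_equal2 +%R (comm_J_V3mx _ _) (comm_V2mx_Qmx _ _))).
exact (Qmx_linear_inj e4).
Qed.

(** By [gq_gp_dx], [gV3q] is the flux q~_x + i (cubic terms), so the evolution equation is a
    conservation law. The same identity shows that [dx qt] is differentiable, although [qt] is only
    known to be C^1. *)
Lemma nlee_q_gauged : nlee_q qt pt <->
  forall x t, ii *: dt qt x t + dx gV3q x t = 0.
Proof.
have e x t : dx (dx qt) x t + ii *: dx cubic_q x t = dx gV3q x t.
  have -> : dx (dx qt) x t = dx gV3q x t - ii *: dx cubic_q x t.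
    have -> : dx qt = fun x t => gV3q x t - ii *: cubic_q x t.
      by apply/funext => y; apply/funext => u; case: (gq_gp_dx y u).
    apply: dxE; apply: is_mderiveB; first exact (class_C_derx x t class_C_gV3q).
    exact (is_mderiveZ ii (class_C_derx x t class_C_cubic_q)).
  by rewrite subrK.
by split=> h x t; have := h x t; rewrite -addrA e.
Qed.

Lemma nlee_p_gauged : nlee_p qt pt <->
  forall x t, ii *: dt pt x t - dx gV3p x t = 0.
Proof.
have e x t : - dx (dx pt) x t + ii *: dx cubic_p x t = - dx gV3p x t.
  have -> : dx (dx pt) x t = dx gV3p x t + ii *: dx cubic_p x t.
    have -> : dx pt = fun x t => gV3p x t + ii *: cubic_p x t.
      by apply/funext => y; apply/funext => u; case: (gq_gp_dx y u).
    apply: dxE; apply: is_mderiveD; first exact (class_C_derx x t class_C_gV3p).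
    exact (is_mderiveZ ii (class_C_derx x t class_C_cubic_p)).
  by rewrite opprD subrK.
by split=> h x t; have := h x t; rewrite -addrA e.
Qed.

(** Both sides of (V~_3)_x = (Q~)_t keep the block shapes of V_3 and Q. The lower block of V_3
    carries a minus sign, whence the opposite signs in front of the two fluxes. *)
Lemma lax1_nlee x t : lax1 x t = 0 <->
  ii *: dt qt x t + dx gV3q x t = 0 /\ ii *: dt pt x t - dx gV3p x t = 0.
Proof.
apply: iff_trans (lax1_gauge x t) _.
have -> : dx (gauge g0 V3) x t = V3mx (dx gV3q x t) (dx gV3p x t).
  have -> : gauge g0 V3 = fun x t => V3mx (gV3q x t) (gV3p x t).
    by apply/funext => y; apply/funext => u; exact: gauge_V3.
  exact (dxE (is_mderive_V3 (class_C_derx x t class_C_gV3q) (class_C_derx x t class_C_gV3p))).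
have -> : dt (gauge g0 Qq) x t = Qmx (dt qt x t) (dt pt x t).
  have -> : gauge g0 Qq = fun x t => Qmx (qt x t) (pt x t).
    by apply/funext => y; apply/funext => u; case: (gauge_QV2 y u).
  exact (dtE (is_mderive_Q (class_C_dert x t class_C_gq) (class_C_dert x t class_C_gp))).
exact (V3mx_eq_Qmx _ _ _ _).
Qed.

Lemma compatible_nlee : compatible q p <-> nlee_q qt pt /\ nlee_p qt pt.
Proof.
split=> [/compatible_lax1 h|[/nlee_q_gauged h1 /nlee_p_gauged h2]].
  split; [apply/nlee_q_gauged => x t|apply/nlee_p_gauged => x t];
  by have /lax1_nlee[] := h x t.
by apply/compatible_lax1 => x t; apply/lax1_nlee.
Qed.

Section LinearSystems.
Variables (lam : C) (k : nat) (psi : R -> R -> 'M[C]_(1 + m + 1, k)).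
Hypothesis cpsi : class_C 1 psi.

Lemma xoper_gauge x t :
  xoper (gLpot g0 q p lam) (fun x t => g0 x t *m psi x t) x t =
  g0 x t *m xoper (Lpot q p lam) psi x t.
Proof.
have e : dx (fun x t => g0 x t *m psi x t) x t =
    dx g0 x t *m psi x t + g0 x t *m dx psi x t.
  exact (dxE (is_mderiveM (class_C_derx x t hg0) (class_C_derx x t cpsi))).
rewrite /xoper e; apply: gauge_x_algebra (ug x t) (hgx x t) (gauge_group_J (gG x t)).
Qed.

Lemma toper_gauge x t :
  toper (gMpot g0 q p lam) (fun x t => g0 x t *m psi x t) x t =
  g0 x t *m toper (Mpot q p lam) psi x t.
Proof.
have e : dt (fun x t => g0 x t *m psi x t) x t =
    dt g0 x t *m psi x t + g0 x t *m dt psi x t.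
  exact (dtE (is_mderiveM (class_C_dert x t hg0) (class_C_dert x t cpsi))).
rewrite /toper e; apply: gauge_t_algebra (ug x t) (hgt x t) (gauge_group_J (gG x t)).
Qed.

End LinearSystems.

End GaugedLaxPair.

Theorem mainTheorem2 (R : realType) (r : nat) (hr : (3 <= r)%N)
    (q p : R -> R -> 'cV[R[i]]_(mid r)) (hq : class_C 2 q) (hp : class_C 2 p)
    (g0 : R -> R -> 'M[R[i]]_(1 + mid r + 1)) (hg0 : class_C 1 g0)
    (hbase : exists x0 t0, gauge_group (g0 x0 t0))
    (hgx : forall x t, 'i%C *: dx g0 x t - g0 x t *m U2f q p x t = 0)
    (hgt : forall x t, 'i%C *: dt g0 x t - g0 x t *m V4f q p x t = 0) :
  [/\ forall x t, g0 x t \in unitmx /\ block_diagonal (g0 x t),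
      forall (lambda : R[i]) (k : nat)
             (psi : R -> R -> 'M[R[i]]_(1 + mid r + 1, k)), class_C 1 psi ->
        let gpsi := fun x t => g0 x t *m psi x t in
        forall x t,
          (xoper (Lpot q p lambda) psi x t = 0 <->
           xoper (gLpot g0 q p lambda) gpsi x t = 0) /\
          (toper (Mpot q p lambda) psi x t = 0 <->
           toper (gMpot g0 q p lambda) gpsi x t = 0),
      forall x t,
        [/\ gauge g0 (Qf q p) x t = Qmx (gq g0 q p x t) (gp g0 q p x t),
            gauge g0 (V2f q p) x t = V2mx (gq g0 q p x t) (gp g0 q p x t)
          & exists a b, gauge g0 (V3f q p) x t = V3mx a b]
    & compatible q p <->
      nlee_q (gq g0 q p) (gp g0 q p) /\ nlee_p (gq g0 q p) (gp g0 q p)].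
Proof.
have hgx' x t := subr0_eq (hgx x t).
have hgt' x t := subr0_eq (hgt x t).
have gG := gauge_group_everywhere hg0 hbase hgx' hgt'.
split.
- move=> x t; split; first exact: gauge_group_unit (gG x t).
  by have [a [A [_ _ ->]]] := gG x t; exists a, A, a^-1.
- move=> lambda k psi cpsi gpsi x t.
  (* Gauging multiplies the residual of each linear equation by the invertible [g0 x t], so
     solutions correspond in both directions. *)
  have z (M : 'M[R[i]]_(1 + mid r + 1, k)) : M = 0 <-> g0 x t *m M = 0.
    exact (mulmx_unit_eq0 M (gauge_group_unit (gG x t))).
  split.
    have e := xoper_gauge hg0 hbase hgx' hgt' lambda cpsi x t.
    by rewrite e; exact (z _).
  have e := toper_gauge hg0 hbase hgx' hgt' lambda cpsi x t.
  by rewrite e; exact (z _).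
- move=> x t; have [eQ eV] := gauge_QV2 hg0 hbase hgx' hgt' x t.
  split; [exact: eQ|exact: eV|].
  by eexists; eexists; exact (gauge_V3 hg0 hbase hgx' hgt' x t).
- exact (compatible_nlee hq hp hg0 hbase hgx' hgt').
Qed.
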